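(* Let $\mathbf V$ be a semigroup variety satisfying a permutational identity of length $3$. Then $\mathbf V$ is a cancellable element of the lattice $\mathbb{SEM}$ of all semigroup varieties if and only if $\mathbf V=\mathbf M\vee\mathbf N$, where $\mathbf M$ is one of the varieties $\mathbf T$ or $\mathbf{SL}$, and $\mathbf N$ is a semigroup variety satisfying the identities $xyz\approx yxz\approx xzy$ and $x^2y\approx 0$.
   Context: $\mathbb{SEM}$ denotes the lattice of all semigroup varieties ordered by inclusion (meet is intersection; join $\mathbf X\vee\mathbf Y$ is the least variety containing $\mathbf X$ and $\mathbf Y$). $\mathbf T$ is the trivial semigroup variety and $\mathbf{SL}$ is the variety of all semilattices (commutative idempotent semigroups). An element $x$ of a lattice $L$ is called cancellable if for all $y,z\in L$, $x\vee y=x\vee z$ and $x\wedge y=x\wedge z$ imply $y=z$. A permutational identity of length $n$ is an identity of the form $x_1x_2\cdots x_n\approx x_{1\pi}x_{2\pi}\cdots x_{n\pi}$, where $\pi$ is a non-trivial permutation of $\{1,2,\dots,n\}$ ($i\pi$ denotes the image of $i$ under $\pi$). For a word $\mathbf u$, the expression $\mathbf u\approx 0$ is short for the pair of identities $t\mathbf u\approx\mathbf ut\approx\mathbf u$, where $t$ is a letter not occurring in $\mathbf u$. *)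

(* Defs.v *)
From HB Require Import structures.
From mathcomp Require Import all_boot all_order all_fingroup.
From mathcomp Require Import boolp classical_sets.

Set Implicit Arguments.
Unset Strict Implicit.
Unset Printing Implicit Defensive.

(* MathComp's [semigroupType] is not used: the universe of its carriers is tied
   to that of [choiceType], so that a type of classes of [semigroupType]s cannot
   be made a [latticeType]. *)
Record semigroup := BuildSemigroup {
  carrier :> Type;
  smul : carrier -> carrier -> carrier;
  smulA : associative smul;
  semigroup_nonempty : inhabited carrier
}.

(* The pair (x, s) stands for the nonempty word x :: s. *)
Definition word : Type := nat * seq nat.

Definition letters (w : word) : seq nat := w.1 :: w.2.

Definition letter (x : nat) : word := (x, [::]).

Definition concat (u v : word) : word := (u.1, u.2 ++ letters v).

Notation "u ⋅ v" := (concat u v) (at level 40, left associativity).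

Definition identity : Type := word * word.

Notation "u ≈ v" := ((u, v) : identity) (at level 70, no associativity).

Definition eval (S : semigroup) (phi : nat -> S) (w : word) : S :=
  foldl (fun a x => smul a (phi x)) (phi w.1) w.2.

Lemma eval_concat (S : semigroup) (phi : nat -> S) (u v : word) :
  eval phi (u ⋅ v) = smul (eval phi u) (eval phi v).
Proof.
case: u v => [x s] [y t]; rewrite /eval /= foldl_cat /=.
elim/last_ind: t => [//|t z IHt]; by rewrite -!cats1 !foldl_cat /= IHt smulA.
Qed.

Definition holds_in (S : semigroup) (e : identity) : Prop :=
  forall phi : nat -> S, eval phi e.1 = eval phi e.2.

Definition models (Sigma : set identity) : semigroup -> Prop :=
  fun S => forall e, Sigma e -> holds_in S e.

Record variety := Variety {
  members :> semigroup -> Prop;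
  varietyP : exists Sigma : set identity, members = models Sigma
}.

Definition variety_of (Sigma : set identity) : variety :=
  @Variety (models Sigma) (ex_intro _ Sigma erefl).

Definition satisfies (V : variety) (e : identity) : Prop :=
  forall S : semigroup, V S -> holds_in S e.

HB.instance Definition _ := gen_eqMixin variety.
HB.instance Definition _ := gen_choiceMixin variety.

Fact variety_display : Order.disp_t.
Proof. exact: Order.Disp tt tt. Qed.

Definition variety_le (X Y : variety) : bool :=
  `[< forall S, members X S -> members Y S >].

Lemma variety_eq (X Y : variety) : members X = members Y -> X = Y.
Proof.
by case: X Y => [X hX] [Y hY] /= eqXY; subst Y; rewrite (Prop_irrelevance hX hY).
Qed.

Lemma variety_le_refl : reflexive variety_le.
Proof. by move=> X; apply/asboolP. Qed.

Lemma variety_le_anti : antisymmetric variety_le.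
Proof.
move=> X Y /andP[/asboolP leXY /asboolP leYX]; apply: variety_eq; apply/funext => S;
by apply/propext; split=> [/leXY|/leYX].
Qed.

Lemma variety_le_trans : transitive variety_le.
Proof.
by move=> Y X Z /asboolP leXY /asboolP leYZ; apply/asboolP => S /leXY /leYZ.
Qed.

HB.instance Definition _ :=
  Order.Le_isPOrder.Build variety_display variety
    variety_le_refl variety_le_anti variety_le_trans.

Lemma variety_meet_subproof (X Y : variety) :
  exists Sigma, (fun S => members X S /\ members Y S) = models Sigma.
Proof.
have [SX eX] := varietyP X; have [SY eY] := varietyP Y.
rewrite eX eY; exists (SX `|` SY)%classic.
apply/funext => S; apply/propext; split=> [[hX hY] e [/hX|/hY]//|hS].
by split=> e he; apply: hS; [left|right].
Qed.

Definition variety_meet (X Y : variety) : variety :=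
  Variety (variety_meet_subproof X Y).

Definition variety_join (X Y : variety) : variety :=
  variety_of [set e | satisfies X e /\ satisfies Y e].

Lemma variety_meetP (X Y Z : variety) :
  (X <= variety_meet Y Z)%O = (X <= Y)%O && (X <= Z)%O.
Proof.
apply/asboolP/andP => [leX|[/asboolP leXY /asboolP leXZ]].
  by split; apply/asboolP => S /leX [].
by move=> S XS; split; [apply: leXY|apply: leXZ].
Qed.

Lemma variety_joinP (X Y Z : variety) :
  (variety_join X Y <= Z)%O = (X <= Z)%O && (Y <= Z)%O.
Proof.
apply/asboolP/andP => [leZ|[/asboolP leXZ /asboolP leYZ] S].
  by split; apply/asboolP => S VS; apply: leZ => e [hX hY]; [apply: hX|apply: hY].
have [SZ eZ] := varietyP Z; rewrite eZ in leXZ leYZ *.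
move=> hS e he; apply: hS.
by split=> S' /= => [/leXZ|/leYZ]; apply.
Qed.

HB.instance Definition _ :=
  Order.POrder_MeetJoin_isLattice.Build variety_display variety
    variety_meetP variety_joinP.

Definition cancellable (d : Order.disp_t) (L : latticeType d) (x : L) : Prop :=
  forall y z : L, (x `|` y = x `|` z)%O -> (x `&` y = x `&` z)%O -> y = z.

Definition trivial_variety : variety :=
  variety_of [set letter 0 ≈ letter 1].

Definition semilattice_variety : variety :=
  variety_of [set e | e = (letter 0 ⋅ letter 0 ≈ letter 0) \/
                      e = (letter 0 ⋅ letter 1 ≈ letter 1 ⋅ letter 0)].

(* The letters x_1, ..., x_n are numbered 0, ..., n - 1. *)
Definition permutational (n : nat) (e : identity) : Prop :=
  exists pi : 'S_n,
    [/\ pi != 1%g,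
        letters e.1 = [seq val i | i <- enum 'I_n] &
        letters e.2 = [seq val (pi i) | i <- enum 'I_n]].

Definition satisfies_zero (V : variety) (u : word) : Prop :=
  forall t : nat, t \notin letters u ->
    satisfies V (letter t ⋅ u ≈ u ⋅ letter t) /\
    satisfies V (u ⋅ letter t ≈ u).

(* Main.v *)
From HB Require Import structures.
Require Import Defs.
From mathcomp Require Import all_boot all_order all_fingroup.
From mathcomp Require Import boolp classical_sets.
From mathcomp Require Import zify.

Set Implicit Arguments.
Unset Strict Implicit.
Unset Printing Implicit Defensive.

(** Varieties are replaced by their fully invariant congruences on words: the join of varieties
    becomes the intersection, and (by Birkhoff's completeness theorem) the meet becomes the
    transitive closure of the union.

    Sufficiency.  Let nu, alpha, beta correspond to V, Y, Z, where V /\ Y = V /\ Z and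
    V \/ Y = V \/ Z.  In N every nonlinear word of length at least 3 is zero, and a nonzero word
    is congruent only to permutations of itself.  On zero words alpha and beta agree.  If a
    nonzero linear word u = x_1 ... x_n is alpha-related to a zero word, it is also beta-related
    to a word that is not a permutation of it.  A congruence that relates u to a word which is not
    a permutation of u satisfies, for some p + q + r = n, q > 0 and m > 0, the identity
    a s b = a s^(m+1) b whenever |a| >= p, |s| >= q, |b| >= r.  Two such identities, one for alpha
    and one for beta, lead from u to a common zero word through rewriting steps between zero
    words, where alpha and beta coincide; hence alpha = beta.

    Necessity.  If one of the required identities fails in V, two different congruences with the
    same join and the same meet with nu are read off words of length 3: two transpositions of the
    letters of xyz outside nu, or congruences exchanging the roles of xyx and xxy. *)

(** * Words and fully invariant congruences *)

(** Agreement of alpha and beta on zero words is immediate only for M = T, where any two zero words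
    are nu-related. For M = SL, nu separates zero words of different content. An alpha-identity
    whose sides differ in content then forces such an identity for beta, and for a common exponent o
    both congruences satisfy (s^o t s^o)^o = s^o; the letters missing from one word can be inserted
    by steps valid for both, which reduces the question to equal contents. A linear word can be
    pumped for one of two reasons: a letter missing on the other side may take two values, or the
    other side is longer and repeats a letter. In the second case, letters fixed at the ends are
    stripped, each raising p or r by one, until the context can grow at both ends; then every word
    over the n letters occurs as a factor of some word related to u. Squares aa, the only nonlinear
    words that can be nonzero, and the reversal of a word of length 2, which may lie outside nu, are
    treated apart. In the necessity part M = SL is chosen when both sides of every identity of V
    have the same content, and M = T otherwise. *)

Definition subst (z : nat -> seq nat) (w : seq nat) : seq nat := flatten (map z w).

HB.lock Definition power (w : seq nat) (k : nat) : seq nat := flatten (nseq k w).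

Definition nonerasing (z : nat -> seq nat) : Prop := forall i, z i != [::].

Record fully_invariant (R : seq nat -> seq nat -> Prop) : Prop := FullyInvariant {
  fi_refl : forall w, R w w;
  fi_sym : forall u v, R u v -> R v u;
  fi_trans : forall v u w, R u v -> R v w -> R u w;
  fi_cat : forall a b u v, R u v -> R (a ++ u ++ b) (a ++ v ++ b);
  fi_subst : forall z u v, nonerasing z -> R u v -> R (subst z u) (subst z v)
}.

Definition pumps (R : seq nat -> seq nat -> Prop) (p q r m : nat) : Prop :=
  forall a s b, p <= size a -> q <= size s -> r <= size b ->
    R (a ++ s ++ b) (a ++ power s m.+1 ++ b).

Lemma subst_cat z u v : subst z (u ++ v) = subst z u ++ subst z v.
Proof. by rewrite /subst map_cat flatten_cat. Qed.

Lemma subst_cons z x u : subst z (x :: u) = z x ++ subst z u.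
Proof. by []. Qed.

Lemma eq_subst z z' w : {in w, z =1 z'} -> subst z w = subst z' w.
Proof. by move=> /eq_in_map eqz; rewrite /subst eqz. Qed.

Lemma subst_single f w : subst (fun i => [:: f i]) w = map f w.
Proof. by elim: w => //= x w IHw; rewrite subst_cons IHw. Qed.

Lemma subst_id w : subst (fun i => [:: i]) w = w.
Proof. by rewrite subst_single map_id. Qed.

Lemma nonnilE (w : seq nat) : (w != [::]) = (0 < size w).
Proof. by case: w. Qed.

Lemma subst_nil z w : nonerasing z -> (subst z w == [::]) = (w == [::]).
Proof. by case: w => // x w /(_ x); rewrite subst_cons; case: (z x). Qed.

Lemma size_subst z w : nonerasing z -> size w <= size (subst z w).
Proof.
move=> nz; elim: w => //= x w IHw; rewrite subst_cons size_cat.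
by have := nz x; case: (z x) => //= *; lia.
Qed.

Lemma power0 s : power s 0 = [::].
Proof. by rewrite power.unlock. Qed.

Lemma powerS s k : power s k.+1 = s ++ power s k.
Proof. by rewrite power.unlock. Qed.

Lemma powerD s j k : power s (j + k) = power s j ++ power s k.
Proof. by rewrite power.unlock nseqD flatten_cat. Qed.

Lemma power1 s : power s 1 = s.
Proof. by rewrite powerS power0 cats0. Qed.

Lemma powerSr s k : power s k.+1 = power s k ++ s.
Proof. by rewrite -addn1 powerD power1. Qed.

Lemma subst_const s w : subst (fun=> s) w = power s (size w).
Proof. by elim: w => [|x w IHw]; rewrite ?power0 // subst_cons IHw powerS. Qed.

Lemma size_power s k : size (power s k) = k * size s.
Proof. by elim: k => [|k IHk]; rewrite ?power0 // powerS size_cat IHk mulSn. Qed.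

Lemma powerM s j k : power s (j * k) = power (power s j) k.
Proof. by elim: k => [|k IHk]; rewrite ?muln0 ?power0 // mulnS powerD IHk powerS. Qed.

Lemma subst_power z s k : subst z (power s k) = power (subst z s) k.
Proof. by elim: k => [|k IHk]; rewrite ?power0 // !powerS subst_cat IHk. Qed.

Lemma mem_subst z w j : reflect (exists2 i, i \in w & j \in z i) (j \in subst z w).
Proof.
apply: (iffP flattenP) => [[s /mapP[i iw ->] js]|[i iw js]]; first by exists i.
by exists (z i) => //; apply: map_f.
Qed.

Section Congruence.
Variables (R : seq nat -> seq nat -> Prop) (RF : fully_invariant R).

Lemma fi_catl a u v : R u v -> R (a ++ u) (a ++ v).
Proof. by move=> /(fi_cat RF a [::]); rewrite !cats0. Qed.

Lemma fi_catr b u v : R u v -> R (u ++ b) (v ++ b).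
Proof. exact: (fi_cat RF [::] b). Qed.

Lemma fi_cat2 u v u' v' : R u v -> R u' v' -> R (u ++ u') (v ++ v').
Proof. by move=> h h'; apply: (fi_trans RF (fi_catr u' h)); apply: fi_catl. Qed.

Lemma fi_power k u v : R u v -> R (power u k) (power v k).
Proof.
by move=> h; elim: k => [|k IHk]; [rewrite !power0; exact: fi_refl|rewrite !powerS; apply: fi_cat2].
Qed.

Lemma fi_rename f u v : R u v -> R (map f u) (map f v).
Proof. by move=> h; rewrite -!subst_single; apply: fi_subst. Qed.

Lemma fi_absorb_power k t u : R u (t ++ u) -> R u (power t k ++ u).
Proof.
move=> h; elim: k => [|k IHk]; first by rewrite power0; apply: fi_refl.
by rewrite powerSr -catA; apply: (fi_trans RF IHk); apply: fi_catl.
Qed.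

(** A factorization into [n] nonempty blocks is a substitution instance of the linear word
    [iota 0 n]. The default [[:: 0]] keeps the substitution nonerasing at letters from [n] on. *)
Lemma fi_blocks n v bs : R (iota 0 n) v -> size bs = n -> all (predC1 [::]) bs ->
  R (flatten bs) (subst (nth [:: 0] bs) v).
Proof.
move=> h szbs nbs; suff -> : flatten bs = subst (nth [:: 0] bs) (iota 0 n).
  apply: (fi_subst RF) => // i; case: (ltnP i (size bs)) => hi; last by rewrite nth_default.
  by move/all_nthP: nbs => /(_ [:: 0] i hi).
by rewrite /subst map_nth_iota0 ?szbs // -szbs take_size.
Qed.

Lemma nth_nonerasing bs : all (predC1 [::]) bs -> nonerasing (nth [:: 0] bs).
Proof.
move=> nbs i; case: (ltnP i (size bs)) => hi; last by rewrite nth_default.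
by move/all_nthP: nbs => /(_ [:: 0] i hi).
Qed.

End Congruence.

(** Serves to strip the first letter of an identity while staying among fully invariant
    relations. *)
Definition left_context (R : seq nat -> seq nat -> Prop) u v :=
  forall c, c != [::] -> R (c ++ u) (c ++ v).

Definition right_context (R : seq nat -> seq nat -> Prop) u v :=
  forall d, d != [::] -> R (u ++ d) (v ++ d).

Lemma fresh_letter (w : seq nat) : exists k, k \notin w.
Proof.
exists (sumn w).+1; have leq_sumn i : i \in w -> i <= sumn w.
  elim: w => //= x w IHw; rewrite in_cons => /orP[/eqP->|/IHw]; lia.
by apply/negP => /leq_sumn; rewrite ltnn.
Qed.

(** For stability under substitution the hypothesis is used with a fresh letter as prefix, which the
    same substitution then sends to [c]. *)
Lemma left_contextF R : fully_invariant R -> fully_invariant (left_context R).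
Proof.
move=> RF; split.
- by move=> w c _; apply: fi_refl.
- by move=> u v h c /h; apply: fi_sym.
- by move=> v u w h1 h2 c nc; apply: (fi_trans RF (h1 c nc)); apply: h2.
- move=> a b u v h c nc; rewrite !catA; apply: fi_catr => //; rewrite -!catA !(catA c).
  by apply: h; case: c nc.
- move=> z u v nz h c nc; have [k] := fresh_letter (u ++ v); rewrite mem_cat => /norP[ku kv].
  have := h [:: k] isT; pose z' i := if i == k then c else z i.
  have nz' : nonerasing z' by move=> i; rewrite /z'; case: ifP.
  move=> /(fi_subst RF nz'); have zk : z' k = c by rewrite /z' eqxx.
  rewrite !subst_cons zk.
  have ez w : k \notin w -> subst z' w = subst z w.
    move=> kw; apply: eq_subst => i iw; rewrite /z'; case: eqP => // ik.
    by rewrite -ik iw in kw.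
  by rewrite !ez.
Qed.

Lemma right_contextF R : fully_invariant R -> fully_invariant (right_context R).
Proof.
move=> RF; split.
- by move=> w c _; apply: fi_refl.
- by move=> u v h c /h; apply: fi_sym.
- by move=> v u w h1 h2 c nc; apply: (fi_trans RF (h1 c nc)); apply: h2.
- move=> a b u v h c nc; rewrite -!catA; apply: fi_catl => //.
  by apply: h; case: b.
- move=> z u v nz h c nc; have [k] := fresh_letter (u ++ v); rewrite mem_cat => /norP[ku kv].
  have := h [:: k] isT; pose z' i := if i == k then c else z i.
  have nz' : nonerasing z' by move=> i; rewrite /z'; case: ifP.
  move=> /(fi_subst RF nz'); have zk : z' k = c by rewrite /z' eqxx.
  rewrite !subst_cat !subst_cons zk !cats0.
  have ez w : k \notin w -> subst z' w = subst z w.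
    move=> kw; apply: eq_subst => i iw; rewrite /z'; case: eqP => // ik.
    by rewrite -ik iw in kw.
  by rewrite !ez.
Qed.

Lemma left_context_pumps R p q r m :
  pumps (left_context R) p q r m -> pumps R p.+1 q r m.
Proof. by move=> h [|x a] s b //= pa qs rb; apply: (h a s b pa qs rb [:: x]). Qed.

Lemma right_context_pumps R p q r m :
  pumps (right_context R) p q r m -> pumps R p q r.+1 m.
Proof.
move=> h a s b pa qs; case/lastP: b => // b x; rewrite size_rcons ltnS => rb.
by have := h a s b pa qs rb [:: x] isT; rewrite -cats1 -!catA.
Qed.

(** * Congruences relating a linear word to a longer word *)

Lemma not_uniq_split (w : seq nat) : ~~ uniq w ->
  exists i A B C, w = A ++ i :: B ++ i :: C.
Proof.
elim: w => //= x w IHw; rewrite negb_and negbK => /orP[xw|/IHw[i [A [B [C ->]]]]].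
  by case/splitPr: xw => B C; exists x, [::], B, C.
by exists i, (x :: A), B, C.
Qed.

(** Otherwise each letter is the successor of the one before it, and the last letter is at least
    [n]. *)
Lemma nonsuccessive_split n (w : seq nat) : n < size w -> all (ltn^~ n) w ->
  exists A k l B, [/\ w = A ++ k :: l :: B, k < n, l < n & l != k.+1].
Proof.
move=> nw wn; case: w nw wn => [|x w] //= nw /andP[xn wn].
have [hw|] := boolP (path (fun k l => l == k.+1) x w).
  have /(_ x w hw) : forall x w, path (fun k l => l == k.+1) x w -> last x w = x + size w.
    move=> {}x {hw wn nw xn}w; elim: w x => [|y w IHw] x /=; first by rewrite addn0.
    by case/andP=> /eqP-> /IHw->; rewrite addSn addnS.
  move=> lw; have : last x w < n.
    by case/lastP: w wn {hw nw lw} => // w y; rewrite all_rcons last_rcons => /andP[].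
  by rewrite lw ltnNge (leq_trans _ (leq_addl x (size w))).
move=> hw {nw}; elim: w x xn wn hw => //= y w IHw x xn /andP[yn wn].
rewrite negb_and; have [_ /= /(IHw y yn wn)[A [k [l [B [e kn ln kl]]]]]|xy _] := eqVneq y x.+1.
  by exists (x :: A), k, l, B; rewrite /= e.
by exists [::], x, y, w.
Qed.

(** * Growing the context of a factor *)

Section Rich.
Variables (R : seq nat -> seq nat -> Prop) (RF : fully_invariant R).
Variables (n : nat) (v : seq nat).
Hypotheses (n_gt0 : 0 < n) (Rv : R (iota 0 n) v) (vn : all (ltn^~ n) v) (szv : n < size v).

Let L w := R (iota 0 n) w.

Lemma step (c : seq nat) bs (d : seq nat) : size bs = n -> all (predC1 [::]) bs ->
  L (c ++ flatten bs ++ d) -> L (c ++ subst (nth [:: 0] bs) v ++ d).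
Proof.
by move=> szbs nbs h; apply: (fi_trans RF h); apply: fi_cat => //; apply: fi_blocks Rv _ _.
Qed.

Let singles (w : seq nat) := map (fun x => [:: x]) w.

Lemma flatten_singles w : flatten (singles w) = w.
Proof. exact: flatten_seq1. Qed.

Lemma all_singles w : all (predC1 [::]) (singles w).
Proof. by elim: w. Qed.

Lemma step1 k (c A b B d : seq nat) : k < n -> b != [::] -> size A = k -> size B = n.-1 - k ->
  L (c ++ A ++ b ++ B ++ d) ->
  exists z, [/\ nonerasing z, z k = b & L (c ++ subst z v ++ d)].
Proof.
move=> kn nb sA sB h; pose bs := singles A ++ b :: singles B.
have szbs : size bs = n by rewrite size_cat /= !size_map; lia.
have nbs : all (predC1 [::]) bs by rewrite all_cat /= !all_singles nb.
exists (nth [:: 0] bs); split; first exact: nth_nonerasing.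
  by rewrite nth_cat size_map sA ltnn subnn.
by apply: step => //; rewrite flatten_cat /= !flatten_singles -!catA.
Qed.

Lemma step2 k l (c A b : seq nat) (Y : seq (seq nat)) (b' B d : seq nat) : k < l -> l < n ->
  b != [::] -> b' != [::] ->
  all (predC1 [::]) Y -> size A = k -> size Y = l - k.+1 -> size B = n.-1 - l ->
  L (c ++ A ++ b ++ flatten Y ++ b' ++ B ++ d) ->
  exists z, [/\ nonerasing z, z k = b, z l = b' & L (c ++ subst z v ++ d)].
Proof.
move=> kl ln nb nb' nY sA sY sB h; pose bs := singles A ++ b :: Y ++ b' :: singles B.
have szbs : size bs = n by rewrite !(size_cat, size_map) /= !(size_cat, size_map) /= !(size_map);
  lia.
have nbs : all (predC1 [::]) bs.
  by rewrite !(all_cat, all_singles) /= nb !(all_cat, all_singles) /= nb' nY all_singles.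
exists (nth [:: 0] bs); split; first exact: nth_nonerasing.
- by rewrite nth_cat size_map sA ltnn subnn.
- rewrite nth_cat size_map sA ltnNge ltnW //= (_ : l - k = (l - k.+1).+1); last lia.
  by rewrite /= nth_cat sY ltnn subnn.
- apply: step => //; rewrite !(flatten_cat,
  flatten_singles) /= flatten_cat /= !flatten_singles -!catA.
  exact: h.
Qed.

Lemma repeated_letter : exists i A B C, i < n /\ v = A ++ i :: B ++ i :: C.
Proof.
have : ~~ uniq v.
  apply/negP => uv; have : size v <= size (iota 0 n).
    by apply: uniq_leq_size => // i iv; rewrite mem_iota; exact: (allP vn).
  by rewrite size_iota; lia.
case/not_uniq_split=> i [A [B [C e]]]; exists i, A, B, C; split => //.
by apply: (allP vn); rewrite e mem_cat in_cons eqxx orbT.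
Qed.

Lemma double i (A B C c P b Q d : seq nat) : v = A ++ i :: B ++ i :: C -> i < n -> b != [::] ->
  size P = i -> size Q = n.-1 - i -> L (c ++ P ++ b ++ Q ++ d) ->
  exists A' B' C', [/\ size A <= size A', size B <= size B', size C <= size C' &
    L (c ++ A' ++ b ++ B' ++ b ++ C' ++ d)].
Proof.
move=> ev i_n nb sP sQ /(step1 i_n nb sP sQ)[z [nz zi]].
rewrite ev !(subst_cat, subst_cons) zi -!catA => h.
by exists (subst z A), (subst z B), (subst z C); split => //; apply: size_subst.
Qed.

(** All of [w] but [n.-1] letters is taken as the block to be doubled. The images of [A], [B], [C]
    have at least [n.-1] letters in all, so the word grows by at least the length of the block. *)
Lemma long_words M : exists2 w, L w & M <= size w.
Proof.
elim: M => [|M [w Lw Mw]]; first by exists v.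
have [nw|wn] := leqP n (size w); last by exists v => //; lia.
have [i [A [B [C [i_n e]]]]] := repeated_letter.
have szABC : n <= (size A + size B + size C).+1.
  by move: szv; rewrite e size_cat /= size_cat /=; lia.
have szw : size w = i + (size w - n.-1) + (n.-1 - i) by lia.
pose P := take i w; pose b := take (size w - n.-1) (drop i w);
  pose Q := drop (size w - n.-1) (drop i w).
have sb : size b = size w - n.-1 by rewrite size_takel ?size_drop; lia.
have [||||A' [B' [C' [sA sB sC h]]]] := double (c := [::]) (d := [::]) (P := P) (b := b) (Q := Q)
  e i_n.
- by rewrite nonnilE sb; lia.
- by rewrite size_takel; lia.
- by rewrite !size_drop; lia.
- by rewrite cats0 !cat_take_drop.
exists (A' ++ b ++ B' ++ b ++ C'); first by move: h; rewrite cats0.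
by rewrite !size_cat; lia.
Qed.

Definition deep (g : seq nat) := forall M, exists C C' : seq nat, [/\ M <= size C,
  M <= size C' & L (C ++ g ++ C')].

Lemma deep_nil : deep [::].
Proof.
move=> M; have [w Lw Mw] := long_words (M + M); exists (take M w), (drop M w).
by rewrite /= cat_take_drop size_drop size_takel; [split => //; lia|lia].
Qed.

Section Deepen.
Variables (V1 V2 U1 U2 : seq nat).
Hypotheses (eV : v = V1 ++ 0 :: V2) (V1_nil : V1 != [::]).
Hypotheses (eU : v = U1 ++ n.-1 :: U2) (U2_nil : U2 != [::]).
Hypothesis full : forall w, L w -> {subset iota 0 n <= w}.

(** As [0] is not the first letter of [v], taking everything but the last [n.-1] letters as block
    [0] puts a nonempty word in front of it. Each round gains a letter on the left of [g] and costs
    fewer than [n] letters on the right. *)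
Lemma deepen_left k r (C g C' : seq nat) : r + k * n <= size C' -> L (C ++ g ++ C') ->
  exists D D', [/\ size C + k <= size D, r <= size D' & L (D ++ g ++ D')].
Proof.
elim: k r C C' => [|k IHk] r C C'; rewrite ?mulSn => hr h.
  by exists C, C'; split => //; lia.
pose m := size C' - n.-1; have hm : m + n.-1 = size C' by rewrite /m; lia.
have [|||||z [nz z0 h']] := @step1 0 [::] [::] (C ++ g ++ take m C') (drop m C') [::] => //.
- by rewrite nonnilE !size_cat size_takel ?leq_subr //; lia.
- by rewrite size_drop; lia.
- by rewrite cats0 /= -!catA cat_take_drop.
move: h'; rewrite cats0 /= eV subst_cat subst_cons z0 => h'.
have := size_subst V1 nz; move: V1_nil; rewrite nonnilE => sV1 sV1'.
have [||D [D' [sD sD' LD]]] := IHk r (subst z V1 ++ C) (take m C' ++ subst z V2).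
- by rewrite size_cat size_takel; lia.
- by move: h'; rewrite -!catA.
by exists D, D'; split => //; rewrite size_cat in sD; lia.
Qed.

Lemma deepen_right k r (C g C' : seq nat) : r + k * n <= size C -> L (C ++ g ++ C') ->
  exists D D', [/\ r <= size D, size C' + k <= size D' & L (D ++ g ++ D')].
Proof.
elim: k r C C' => [|k IHk] r C C'; rewrite ?mulSn => hr h.
  by exists C, C'; split => //; lia.
pose A := take n.-1 C; pose b := drop n.-1 C ++ g ++ C'.
have [|||||z [nz z0 h']] := @step1 n.-1 [::] A b [::] [::] => //.
- by lia.
- by rewrite nonnilE !size_cat size_drop; lia.
- by rewrite size_takel; lia.
- by rewrite /=; lia.
- by rewrite /= !cats0 catA cat_take_drop.
move: h'; rewrite cats0 /= eU subst_cat subst_cons z0 => h'.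
have := size_subst U2 nz; move: U2_nil; rewrite nonnilE => sU2 sU2'.
have [||D [D' [sD sD' LD]]] := IHk r (subst z U1 ++ drop n.-1 C) (C' ++ subst z U2).
- by rewrite size_cat size_drop; lia.
- by move: h'; rewrite -!catA.
by exists D, D'; split => //; rewrite size_cat in sD'; lia.
Qed.

(* A word around [g] contains [y]; doubling the block that contains both gives [g] and [y] in
   either order, at arbitrary distances. *)
Lemma deep_both g y M : deep g -> y < n ->
  (exists P1 P2 P3, [/\ M <= size P1, M <= size P2, M <= size P3 &
                       L (P1 ++ g ++ P2 ++ y :: P3)]) /\
  (exists P1 P2 P3, [/\ M <= size P1, M <= size P2, M <= size P3 &
                       L (P1 ++ y :: P2 ++ g ++ P3)]).
Proof.
(* [K * n] letters pay for [K] rounds of deepening when [y] lies close to an end; of the [K] letters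
   then available on each side, at most [n] are spent as single-letter blocks. *)
move=> dg yn; pose K := M + n; have [C [C' [sC sC' h]]] := dg (K + K * n).
have [G [G1 [G2 [H1 [H2 [D [D' [sD sD' h' eG eH]]]]]]]] : exists G G1 G2 H1 H2 D D',
    [/\ K <= size D, K <= size D', L (D ++ G ++ D'), G = G1 ++ y :: G2 & G = H1 ++ g ++ H2].
  have /(full h) : y \in iota 0 n by rewrite mem_iota.
  rewrite !mem_cat => /or3P[] /splitPr yin.
  - case: yin h sC => C1 C2; rewrite -catA cat_cons => h sC.
    have [|D [D' [sD sD' h']]] := @deepen_left K K C1 (y :: C2 ++ g) C' sC';
      first by rewrite /= -catA.
    exists (y :: C2 ++ g), [::], (C2 ++ g), (y :: C2), [::], D, D'; split => //; first by lia.
    by rewrite cats0.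
  - case: yin h => G1 G2 h; exists (G1 ++ y :: G2), G1, G2, [::], [::], C, C'.
    by split => //; rewrite ?cats0 //; lia.
  - case: yin h sC' => C1 C2 h sC'.
    have [|D [D' [sD sD' h']]] := @deepen_right K K C (g ++ C1 ++ [:: y]) C2 sC.
      by move: h; rewrite -!catA.
    exists (g ++ C1 ++ [:: y]), (g ++ C1), [::], [::], (C1 ++ [:: y]), D, D'; split => //;
      first by lia.
    by rewrite -catA.
have [i [A [B [E [i_n e]]]]] := repeated_letter.
pose b := drop i D ++ G ++ take (size D' - (n.-1 - i)) D'.
have [||||A' [B' [C'' [_ _ _ h'']]]] := double (c := [::]) (d := [::]) (P := take i D) (b := b)
    (Q := drop (size D' - (n.-1 - i)) D') e i_n.
- by rewrite nonnilE !size_cat size_drop; lia.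
- by rewrite size_takel; lia.
- by rewrite size_drop; lia.
- by rewrite cats0 /= /b -!catA cat_take_drop catA cat_take_drop.
move: h''; rewrite cats0 /= /b; set X := drop i D; set Y := take _ D'.
have sX : M <= size X by rewrite size_drop; lia.
have sY : M <= size Y by rewrite size_takel; lia.
move=> h''; split.
  exists (A' ++ X ++ H1), (H2 ++ Y ++ B' ++ X ++ G1), (G2 ++ Y ++ C'').
  split; rewrite ?size_cat; try lia.
  by move: h''; rewrite {1}eH eG -!catA.
exists (A' ++ X ++ G1), (G2 ++ Y ++ B' ++ X ++ H1), (H2 ++ Y ++ C'').
split; rewrite ?size_cat; try lia.
by move: h''; rewrite {1}eG eH -!catA.
Qed.

(* [v] has adjacent letters [k], [l] with [l != k.+1]; substituting a block that ends in [g] for [k]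
   and a block that begins with [y] for [l] creates [g ++ [:: y]]. *)
Lemma deep_rcons g y : deep g -> y < n -> deep (g ++ [:: y]).
Proof.
move=> dg yn M; have [A [k [l [B [e kn ln]]]]] := nonsuccessive_split szv vn.
have [[P1 [P2 [P3 [s1 s2 s3 h]]]] [Q1 [Q2 [Q3 [t1 t2 t3 h']]]]] :=
  deep_both (M + M + n) dg yn.
have found z c d T1 T2 : nonerasing z -> L (c ++ subst z v ++ d) ->
    z k = T1 ++ g -> z l = y :: T2 -> M <= size T1 -> M <= size T2 ->
    exists C C', [/\ M <= size C, M <= size C' & L (C ++ (g ++ [:: y]) ++ C')].
  move=> nz; rewrite e subst_cat !subst_cons => hL zk zl sT1 sT2.
  exists (c ++ subst z A ++ T1), (T2 ++ subst z B ++ d); split; rewrite ?size_cat; try lia.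
  by move: hL; rewrite zk zl -!catA.
(* The order of [k] and [l] decides whether [g] or [y] must come first in the word that is cut into
   blocks; for [k = l] the single block [y :: Q2 ++ g] follows itself. *)
case: (ltngtP k l) => [kl|lk|kl] lk1.
- have kl1 : k.+1 < l by rewrite ltn_neqAle eq_sym lk1.
  pose m := size P2 - (l - k.+2); pose m3 := size P3 - (n.-1 - l).
  have [|||||||z [nz zk zl hz]] := @step2 k l [::] (take k P1) (drop k P1 ++ g)
    (take m P2 :: singles (drop m P2)) (y :: take m3 P3) (drop m3 P3) [::] kl ln.
  + by rewrite nonnilE size_cat size_drop; lia.
  + by [].
  + by rewrite /= all_singles andbT nonnilE size_takel /m; lia.
  + by rewrite size_takel; lia.
  + by rewrite /= size_map size_drop /m; lia.
  + by rewrite size_drop /m3; lia.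
  + rewrite cats0 /= flatten_singles -!catA cat_take_drop (catA (take m P2)) cat_take_drop.
    by rewrite (catA (take k P1)) cat_take_drop.
  apply: (found _ _ _ _ _ nz hz zk zl); rewrite ?size_drop ?size_takel /m3; lia.
- pose m := size Q1 - l; pose m3 := n.-1 - k.
  have [|||||||z [nz zl zk hz]] := @step2 l k (take m Q1) (drop m Q1) (y :: take M Q2)
    (singles (take (k - l.+1) (drop M Q2))) (drop (k - l.+1) (drop M Q2) ++ g)
    (take m3 Q3) (drop m3 Q3) lk kn.
  + by [].
  + by rewrite nonnilE size_cat !size_drop; lia.
  + exact: all_singles.
  + by rewrite size_drop /m; lia.
  + by rewrite size_map size_takel ?size_drop; lia.
  + by rewrite size_takel /m3; lia.
  + rewrite flatten_singles cat_take_drop -!catA (catA (take (k - l.+1) _)) cat_take_drop.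
    by rewrite cat_cons (catA (take M Q2)) cat_take_drop (catA (take m Q1)) cat_take_drop.
  apply: (found _ _ _ _ _ nz hz zk zl); rewrite ?size_drop ?size_takel; lia.
- subst l; pose m := size Q1 - k; pose m3 := n.-1 - k.
  have [|||||z [nz zk hz]] := @step1 k (take m Q1) (drop m Q1) (y :: Q2 ++ g)
    (take m3 Q3) (drop m3 Q3) => //.
  + by rewrite size_drop /m; lia.
  + by rewrite size_takel /m3; lia.
  + by rewrite cat_take_drop (catA (take m Q1)) cat_take_drop cat_cons -!catA.
  apply: (found z _ _ (y :: Q2) (Q2 ++ g) nz hz); rewrite ?zk //= ?size_cat; lia.
Qed.

Lemma deep_word g : all (ltn^~ n) g -> deep g.
Proof.
elim/last_ind: g => [|g y IHg]; first by move=> _; apply: deep_nil.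
by rewrite all_rcons => /andP[yn /IHg dg]; rewrite -cats1; apply: deep_rcons.
Qed.

(* Some related word contains two consecutive copies of [u]: inserting powers of the context
   on their left yields an idempotent [E] and a word [t = E u] with [u ~ t ~ t^(k+1)]. *)
Lemma deep_pumps : exists2 m, 0 < m & pumps R 0 n 0 m.
Proof.
pose u := iota 0 n.
have un : all (ltn^~ n) (u ++ u).
  by rewrite all_cat andbb; apply/allP => i; rewrite mem_iota.
have [C [C' [_ _ h]]] := deep_word un 0.
pose P := C ++ u; pose d := size v - n.
have RP : R (power P n) (power P (n + d)).
  have := @fi_subst _ RF (fun=> P) _ _ _ Rv; rewrite !subst_const size_iota.
  rewrite /d subnKC 1?ltnW //; apply => _; rewrite nonnilE size_cat size_iota; lia.
have uPk k : R u (power P k ++ u ++ power C' k).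
  elim: k => [|k IHk]; first by rewrite !power0 cats0; apply: fi_refl.
  apply: (fi_trans RF IHk).
  have -> : power P k.+1 ++ u ++ power C' k.+1 =
            power P k ++ (C ++ (u ++ u) ++ C') ++ power C' k.
    by rewrite powerSr (powerS C') /P -!catA.
  exact: fi_cat.
pose R' := power P d.
have uR' : R u (R' ++ u).
  apply: (fi_trans RF (uPk n)); apply: (fi_sym RF).
  apply: (fi_trans RF (fi_catl RF R' (uPk n))); rewrite catA -powerD addnC.
  by apply: fi_catr => //; apply: (fi_sym RF).
have RPk j : R (power P (n + j)) (power P (n + j + d)).
  rewrite (addnC n) -addnA (powerD _ j) (powerD _ j); exact: fi_catl.
have RPdk k j : R (power P (n + j)) (power P (n + j + k * d)).
  elim: k => [|k IHk]; first by rewrite addn0; apply: fi_refl.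
  apply: (fi_trans RF IHk); have := RPk (j + k * d).
  by rewrite addnA -[_ + d]addnA -mulSnr.
have d0 : 0 < d by rewrite subn_gt0.
pose E := power R' n; have REE : R E (E ++ E).
  rewrite /E -powerD /R' -!powerM.
  have -> : d * n = n + (d * n - n) by rewrite subnKC // leq_pmull.
  have -> : d * (n + n) = n + (d * n - n) + n * d by nia.
  exact: RPdk.
have uE : R u (E ++ u) by apply: fi_absorb_power.
pose t := E ++ u; have tE : R t (E ++ t) by rewrite /t catA; apply: fi_catr.
have tEk k : R t (power E k ++ t) by apply: fi_absorb_power.
have E_nil : E != [::].
  rewrite nonnilE /E /R' !size_power size_cat size_iota; lia.
(* Under [z] the word [u] becomes [E^(n-1) t], related to [t], while [R' u] becomes a power of [t],
   since each [E] is absorbed by the [t] to its right. The exponent is one more than the number of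
   occurrences of [n.-1] in [R']. *)
pose z i := if i == n.-1 then t else E.
have nz : nonerasing z.
  by move=> i; rewrite /z; case: ifP => _ //; rewrite nonnilE size_cat size_iota; lia.
have zu : R (subst z u) t.
  have -> : u = iota 0 n.-1 ++ [:: n.-1] by rewrite /u -[in LHS](prednK n_gt0) -addn1 iotaD.
  rewrite subst_cat subst_cons cats0 {2}/z eqxx (_ : subst z _ = power E n.-1).
    by apply: (fi_sym RF).
  rewrite -[in RHS](size_iota 0 n.-1) -subst_const; apply: eq_subst => i.
  by rewrite mem_iota /z /= add0n; case: eqP => // ->; rewrite ltnn.
have zt w : R (subst z w ++ t) (power t (count_mem n.-1 w).+1).
  elim: w => [|i w IHw]; first by rewrite /= power1; apply: fi_refl.
  rewrite subst_cons -catA /= {1}/z; apply: (fi_trans RF (fi_catl RF _ IHw)).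
  case: eqP => _; rewrite ?add0n ?add1n -?powerS; first exact: fi_refl.
  by rewrite powerS catA; apply: fi_catr => //; apply: (fi_sym RF).
pose k := count_mem n.-1 R'.
have k0 : 0 < k.
  rewrite -has_count has_pred1 /R' -(prednK d0) powerS /P !mem_cat mem_iota.
  by rewrite (_ : _ <= _ < _) ?orbT //; lia.
have tt : R t (power t k.+1).
  have := fi_subst RF nz uR'; rewrite subst_cat => huR.
  apply: (fi_trans RF (fi_sym RF zu)); apply: (fi_trans RF huR).
  by apply: (fi_trans RF (fi_catl RF _ zu)); apply: zt.
have uk : R u (power u k.+1).
  apply: (fi_trans RF uE); apply: (fi_trans RF tt); apply: fi_power => //.
  exact: (fi_sym RF).
exists k => // a s b _ ns _; apply: fi_cat => //.
pose bs := singles (take n.-1 s) ++ [:: drop n.-1 s].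
have szbs : size bs = n by rewrite size_cat size_map size_takel /=; lia.
have nbs : all (predC1 [::]) bs.
  by rewrite all_cat all_singles /= andbT nonnilE size_drop; lia.
have := fi_blocks RF uk szbs nbs; rewrite subst_power.
have -> : subst (nth [:: 0] bs) u = flatten bs.
  by rewrite /subst /u map_nth_iota0 ?szbs // -szbs take_size.
by rewrite /bs flatten_cat flatten_singles /= cats0 cat_take_drop.
Qed.
End Deepen.
End Rich.

(** The image of [v] does not depend on what is substituted for [i], so the blocks [s] and [s s] in
    position [i] give related words. *)
Lemma missing_pumps R n v i : fully_invariant R -> R (iota 0 n) v -> i < n -> i \notin v ->
  pumps R i 1 (n - i.+1) 1.
Proof.
move=> RF Rv i_n iv a s b; rewrite -nonnilE => ha hs hb.
pose A := drop (size a - i) a; pose B := take (n - i.+1) b.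
have sA : size A = i by rewrite size_drop; lia.
have sB : size B = n - i.+1 by rewrite size_takel.
pose bs t := map (cons^~ [::]) A ++ t :: map (cons^~ [::]) B.
have szbs t : size (bs t) = n by rewrite size_cat /= !size_map; lia.
have alls (w : seq nat) : all (predC1 [::]) (map (cons^~ [::]) w) by elim: w.
have nbs t : t != [::] -> all (predC1 [::]) (bs t) by move=> nt; rewrite all_cat /= !alls nt.
have fl t : flatten (bs t) = A ++ t ++ B by rewrite /bs flatten_cat /= !flatten_seq1.
have key : R (A ++ s ++ B) (A ++ power s 2 ++ B).
  have ns2 : power s 2 != [::] by rewrite nonnilE size_power; rewrite nonnilE in hs; lia.
  have h1 := fi_blocks RF Rv (szbs s) (nbs s hs).
  have h2 := fi_blocks RF Rv (szbs (power s 2)) (nbs _ ns2).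
  rewrite !fl in h1 h2; apply: (fi_trans RF h1); apply: (fi_sym RF).
  rewrite (_ : subst (nth _ (bs s)) v = subst (nth [:: 0] (bs (power s 2))) v) //.
  apply: eq_subst => j jv; rewrite !nth_cat size_map sA; case: ltnP => // ij.
  by case e: (j - i) => [|k] //; rewrite (_ : j = i) in jv; [rewrite jv in iv|lia].
have -> : a = take (size a - i) a ++ A by rewrite cat_take_drop.
have -> : b = B ++ drop (n - i.+1) b by rewrite cat_take_drop.
by have := fi_cat RF (take (size a - i) a) (drop (n - i.+1) b) key; rewrite -!catA.
Qed.

Definition pumps_somewhere (R : seq nat -> seq nat -> Prop) (n : nat) : Prop :=
  exists p q r m, [/\ 0 < q, 0 < m, p + q + r = n & pumps R p q r m].

(** Induction on the number of letters. If [0] occurs in [v] only as its first letter, it is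
    stripped and the rest of the identity holds in [left_context R], at the cost of one unit of [p];
    likewise at the right end. Otherwise some [0] has a letter before it and some occurrence of the
    last letter of the alphabet has one behind it, as [deep_pumps] requires. *)
Lemma pumps_of_long_identity n : forall R v, fully_invariant R -> 0 < n -> R (iota 0 n) v ->
  all (ltn^~ n) v -> n < size v -> pumps_somewhere R n.
Proof.
elim: n => // n IHn R v RF _ Rv vn szv.
have [[w [i [Rw i_n iw]]]|full] :=
    pselect (exists w i, [/\ R (iota 0 n.+1) w, i < n.+1 & i \notin w]).
  exists i, 1, (n.+1 - i.+1), 1; split => //; first by lia.
  exact: missing_pumps Rw i_n iw.
have {}full w : R (iota 0 n.+1) w -> {subset iota 0 n.+1 <= w}.
  move=> Rw i; rewrite mem_iota => i_n; apply/negPn/negP => iw.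
  by apply: full; exists w, i.
case: (boolP ((head 1 v == 0) && (0 \notin behead v))) => [/andP[v0 nv]|hV].
  case: v v0 nv vn szv Rv => //= x v /eqP-> v0 vn szv Rv.
  have v_gt0 : all (leq 1) v by apply/allP => -[|i] //; rewrite (negPf v0).
  have n_gt0 : 0 < n.
    have : 0 < size v by move: szv; case: (v) => //; lia.
    case: (v) vn v_gt0 => //= y ? /andP[yn _] /andP[y0 _] _; exact: leq_trans y0 yn.
  have LR : left_context R (iota 0 n) (map predn v).
    move=> c nc; pose z i := if i is i'.+1 then [:: i'] else c.
    have nz : nonerasing z by case.
    have := fi_subst RF nz Rv; rewrite !subst_cons /=.
    have -> : subst z (iota 1 n) = iota 0 n.
      by rewrite (iotaDl 1 0) /subst -map_comp (eq_map (_ : _ =1 cons^~ [::])) // flatten_seq1.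
    have -> : subst z v = map predn v; last by [].
    by rewrite -subst_single; apply: eq_subst => -[|i] // i0; rewrite i0 in v0.
  have [||//|||p [q [r [m [q0 m0 e h]]]]] := IHn (left_context R) (map predn v).
  - exact: left_contextF.
  - by [].
  - rewrite all_map; apply/allP => i iv /=; have := allP v_gt0 i iv.
    by have := allP vn i iv; rewrite /=; lia.
  - by rewrite size_map.
  exists p.+1, q, r, m; split => //; first by lia.
  exact: left_context_pumps.
case: (boolP ((last n.+1 v == n) && (n \notin belast (head 0 v) (behead v)))) => [/andP[vl nv]|hU].
  case/lastP: v vl nv vn szv Rv hV => // v x; rewrite last_rcons => /eqP-> nv vn szv Rv _.
  have {}nv : n \notin v by case: v nv {vn szv Rv} => // y v; rewrite /= belast_rcons.
  rewrite size_rcons ltnS in szv; rewrite all_rcons in vn; case/andP: vn => _ vn.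
  have {}vn : all (ltn^~ n) v.
    apply/allP => i iv; have := allP vn i iv; rewrite /= ltnS leq_eqVlt.
    by case/predU1P => // e; rewrite -e iv in nv.
  have n_gt0 : 0 < n.
    by move: vn szv; case: (v) => // y ? /= /andP[]; case: (n).
  have LR : right_context R (iota 0 n) v.
    move=> d nd; pose z i := if i == n then d else [:: i].
    have nz : nonerasing z by move=> i; rewrite /z; case: ifP.
    have := fi_subst RF nz Rv; rewrite -cats1 -addn1 iotaD !subst_cat !subst_cons /= !cats0.
    have zn : z n = d by rewrite /z eqxx.
    rewrite zn.
    have zid w : n \notin w -> subst z w = w.
      move=> nw; rewrite -[RHS]subst_id; apply: eq_subst => i iw; rewrite /z.
      by case: eqP => // e; rewrite -e iw in nw.
    by rewrite !zid // mem_iota add0n ltnn andbF.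
  have [||//|||p [q [r [m [q0 m0 e h]]]]] := IHn (right_context R) v.
  - exact: right_contextF.
  - by [].
  - by [].
  - by [].
  exists p, q, r.+1, m; split => //; first by lia.
  exact: right_context_pumps.
have mem0 : 0 \in v by apply: full Rv _ _; rewrite mem_iota.
have memn : n \in v by apply: full Rv _ _; rewrite mem_iota; lia.
have [V1 [V2 [eV V1n]]] : exists V1 V2, v = V1 ++ 0 :: V2 /\ V1 != [::].
  case: v mem0 hV {Rv vn szv hU memn} => //= x v; rewrite in_cons.
  case: eqP => [<- _ /=|_ /= v0 _]; last first.
    by case/splitPr: v0 => A B; exists (x :: A), B.
  by rewrite negbK => v0; case/splitPr: v0 => A B; exists (0 :: A), B.
have [U1 [U2 [eU U2n]]] : exists U1 U2, v = U1 ++ n :: U2 /\ U2 != [::].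
  case/lastP: v memn hU {Rv vn szv hV mem0 eV} => // v x; rewrite mem_rcons in_cons last_rcons.
  have -> : belast (head 0 (rcons v x)) (behead (rcons v x)) = v.
    by case: v => // y v; rewrite /= belast_rcons.
  case: eqP => [<- _|_ /= nv _]; rewrite ?eqxx ?negbK => /=; last first.
    by case/splitPr: nv => A B; exists A, (rcons B x); rewrite rcons_cat; case: (B).
  by move=> nv; case/splitPr: nv => A B; exists A, (rcons B n); rewrite rcons_cat; case: (B).
have [m m0 h] := @deep_pumps R RF n.+1 v isT Rv vn szv V1 V2 U1 U2 eV V1n eU U2n full.
by exists 0, n.+1, 0, m; split => //; rewrite addn0.
Qed.

Lemma pumps_of_identity R n v : fully_invariant R -> 0 < n -> R (iota 0 n) v ->
  ~~ perm_eq v (iota 0 n) -> pumps_somewhere R n.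
Proof.
move=> RF n0 Rv vp.
case: (boolP (all (mem v) (iota 0 n))) => [/allP all_v|/allPn[i]]; last first.
  rewrite mem_iota => i_n iv; exists i, 1, (n - i.+1), 1; split => //; first by lia.
  exact: missing_pumps Rv i_n iv.
(* Foreign letters are renamed to [0]; this fixes [iota 0 n] and keeps the length of [v], which
   exceeds [n]. *)
pose f i := if i < n then i else 0.
have fn i : i < n -> f i = i by rewrite /f => ->.
have szv : n < size v.
  have le := uniq_leq_size (iota_uniq 0 n) all_v; rewrite size_iota in le.
  rewrite ltn_neqAle le andbT; apply: contraNneq vp => e.
  rewrite perm_sym; apply: uniq_perm; rewrite ?iota_uniq //.
    by rewrite (leq_size_uniq (iota_uniq 0 n) all_v) // size_iota e.
  by have [|] := uniq_min_size (iota_uniq 0 n) all_v; rewrite ?size_iota ?e.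
apply: (@pumps_of_long_identity n R (map f v)) => //.
- have := fi_rename RF f Rv; congr (R _ _); rewrite -[RHS]map_id; apply/eq_in_map => i.
  by rewrite mem_iota => /fn.
- by apply/allP => i /mapP[j _ ->]; rewrite /f /=; case: ifP.
- by rewrite size_map.
Qed.

(** * Joining two periodic identities *)

Definition long_nonlinear (w : seq nat) : bool := (2 < size w) && ~~ uniq w.

Lemma long_nonlinear_power (a s : seq nat) k (b : seq nat) : s != [::] -> 2 < k ->
  long_nonlinear (a ++ power s k ++ b).
Proof.
case: s => // x s _ k2; rewrite -(subnKC k2) powerD.
set w := power _ (k - 3); rewrite /long_nonlinear; apply/andP; split.
  by rewrite !size_cat size_power /=; lia.
apply/negP => /(count_uniq_mem x) e; have := leq_b1 (x \in a ++ (power (x :: s) 3 ++ w) ++ b).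
by rewrite -e !powerS !count_cat /= !eqxx; lia.
Qed.

Lemma pumps_mul R p q r m k : fully_invariant R -> pumps R p q r m -> pumps R p q r (k * m).
Proof.
move=> RF h a s b ha hs hb; elim: k => [|k IHk].
  by rewrite mul0n power1; apply: fi_refl.
apply: (fi_trans RF IHk); rewrite mulSnr -addnS powerD powerSr -!catA.
rewrite catA [X in R _ X]catA; apply: h => //; rewrite size_cat; lia.
Qed.

Lemma split_size (w : seq nat) i j : size w = i + j ->
  exists x y, [/\ w = x ++ y, size x = i & size y = j].
Proof.
move=> h; exists (take i w), (drop i w).
by rewrite cat_take_drop size_drop size_takel; [split => //; lia|lia].
Qed.

Section Agreement.
Variables (R S : seq nat -> seq nat -> Prop).
Hypotheses (RF : fully_invariant R) (SF : fully_invariant S).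
Hypothesis RS : forall u v, long_nonlinear u -> long_nonlinear v -> R u v <-> S u v.

(** [R] raises the inner factor [s], and [S] the outer factor [t]. [S] passes from [t] to [t^(m+1)];
    replacing each [t] by [t'] is an [R] step between long nonlinear words, hence an [S] step;
    finally [S] lowers [t'^(m+1)] to [t']. *)
Lemma pumps_nested p q r p' q' r' m (a c s d b : seq nat) : 1 < m -> s != [::] ->
  pumps R p q r m -> pumps S p' q' r' m ->
  p <= size (a ++ c) -> q <= size s -> r <= size (d ++ b) ->
  p' <= size a -> q' <= size (c ++ s ++ d) -> r' <= size b ->
  let u := a ++ c ++ s ++ d ++ b in
  exists e, [/\ long_nonlinear e, R u e & S u e].
Proof.
move=> m1 ns hR hS hp hq hr hp' hq' hr' /=; pose e := (a ++ c) ++ power s m.+1 ++ (d ++ b).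
exists e; split; first by apply: long_nonlinear_power.
  by have := hR _ _ _ hp hq hr; rewrite /e -!catA.
pose t := c ++ s ++ d; pose t' := c ++ power s m.+1 ++ d.
have nt : t != [::] by rewrite nonnilE !size_cat; rewrite nonnilE in ns; lia.
have nt' : t' != [::].
  by rewrite nonnilE !size_cat size_power; rewrite nonnilE in ns; nia.
have key k : forall a', size a <= size a' -> R (a' ++ power t k ++ b) (a' ++ power t' k ++ b).
  elim: k => [|k IHk] a' ha; first by rewrite !power0; apply: fi_refl.
  have h1 := IHk (a' ++ t); rewrite size_cat in h1; rewrite !powerS.
  have {}h1 : R (a' ++ (t ++ power t k) ++ b) ((a' ++ t) ++ power t' k ++ b).
    by have := h1 (leq_trans ha (leq_addr _ _)); rewrite -!catA.
  apply: (fi_trans RF h1).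
  have := hR (a' ++ c) s (d ++ power t' k ++ b); rewrite /t' -!catA; apply => //.
    by move: hp ha; rewrite !size_cat; lia.
  by move: hr; rewrite !size_cat; lia.
have h0 : S (a ++ t ++ b) (a ++ power t m.+1 ++ b) by apply: hS.
have h1 : S (a ++ power t m.+1 ++ b) (a ++ power t' m.+1 ++ b).
  by apply/RS; [exact: long_nonlinear_power..|exact: key].
have h2 : S (a ++ t' ++ b) (a ++ power t' m.+1 ++ b).
  apply: hS => //; move: hq'; rewrite !size_cat size_power mulSn; lia.
have := fi_trans SF (fi_trans SF h0 h1) (fi_sym SF h2).
by rewrite /t /t' /e -!catA.
Qed.

(** [S] reaches [e] directly. Under [R] the factor [s] is raised first, which makes the raising of
    [s'] by [S] a step between long nonlinear words, hence an [R] step; then [s] is lowered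
    again. *)
Lemma pumps_crossing p q r p' q' r' m (a s b c s' d b' : seq nat) : 1 < m -> s != [::] ->
  s' != [::] ->
  pumps R p q r m -> pumps S p' q' r' m ->
  p <= size a -> q <= size s -> r <= size b ->
  p' <= size (a ++ c) -> q' <= size s' -> r' <= size b' ->
  s ++ d = c ++ s' -> b = d ++ b' ->
  let u := a ++ s ++ b in
  exists e, [/\ long_nonlinear e, R u e & S u e].
Proof.
move=> m1 ns ns' hR hS hp hq hr hp' hq' hr' esd eb /=.
have esd' z : s ++ d ++ z = c ++ s' ++ z by rewrite catA esd -catA.
pose e := (a ++ c) ++ power s' m.+1 ++ b'; exists e; split; first exact: long_nonlinear_power.
  have h0 : R (a ++ s ++ b) (a ++ power s m.+1 ++ b) by apply: hR.
  pose y := a ++ power s m.+1 ++ (d ++ power s' m ++ b').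
  have h1 : S (a ++ power s m.+1 ++ b) y.
    have -> : a ++ power s m.+1 ++ b = (a ++ power s m ++ c) ++ s' ++ b'.
      by rewrite (powerSr s) eb -!catA esd'.
    have -> : y = (a ++ power s m ++ c) ++ power s' m.+1 ++ b'.
      by rewrite /y (powerSr s) (powerS s') -!catA esd'.
    by apply: hS => //; move: hp'; rewrite !size_cat; lia.
  have h2 : R y (a ++ s ++ (d ++ power s' m ++ b')).
    apply: (fi_sym RF); apply: hR => //; move: hr; rewrite eb !size_cat; lia.
  apply: (fi_trans RF h0).
  have {}h1 : R (a ++ power s m.+1 ++ b) y by apply/RS => //; apply: long_nonlinear_power.
  by apply: (fi_trans RF h1); move: h2; rewrite esd' /e powerS -!catA.
have := hS _ s' b' hp' hq' hr'.
by rewrite eb esd' /e -!catA.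
Qed.
End Agreement.

Lemma pumps_agree R S n u : fully_invariant R -> fully_invariant S ->
  (forall u v, long_nonlinear u -> long_nonlinear v -> R u v <-> S u v) ->
  pumps_somewhere R n -> pumps_somewhere S n -> size u = n ->
  exists e, [/\ long_nonlinear e, R u e & S u e].
Proof.
move=> RF SF RS [p [q [r [m [q0 m0 e hR]]]]] [p' [q' [r' [m' [q0' m0' e' hS]]]]] su.
(* A common multiple gives both congruences the same exponent; the factor 2 makes it exceed 1, so
   that powers [M.+1] are long and nonlinear. *)
pose M := 2 * m * m'; have M1 : 1 < M by rewrite /M; nia.
have {}hR : pumps R p q r M by rewrite /M mulnAC; apply: pumps_mul.
have {}hS : pumps S p' q' r' M by apply: pumps_mul.
clearbody M; clear m m' m0 m0'.
(* By symmetry the factor raised by [S] ends no earlier than that of [R]. Either it contains the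
   latter, or it also begins no earlier. *)
wlog : R S p q r p' q' r' RF SF RS q0 q0' e e' hR hS / (r' <= r) && ((p <= p') || (p' <= p)).
  move=> WL; case: (leqP r' r) => rr; first by apply: (WL R S p q r p' q' r');
    rewrite ?rr ?leq_total.
  have [||x [lx Sx Rx]] := WL S R p' q' r' p q r SF RF _ q0' q0 e' e hS hR _.
  - by move=> x y lx ly; apply: iff_sym; apply: RS.
  - by rewrite (ltnW rr) leq_total.
  by exists x.
case/andP=> rr /orP[pp|pp]; last first.
  have [a [x [eu sa sx]]] : exists x y, [/\ u = x ++ y, size x = p' & size y = (p - p') + q + r].
    by apply: split_size; lia.
  have [c [x' [ec sc sx']]] : exists y z, [/\ x = y ++ z, size y = p - p' & size z = q + r].
    by apply: split_size; lia.
  have [s [x'' [es ss sx'']]] := split_size sx'.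
  have [d [b [ed sd sb]]] : exists y z, [/\ x'' = y ++ z, size y = r - r' & size z = r'].
    by apply: split_size; lia.
  rewrite eu ec es ed; apply: (pumps_nested RF SF RS M1 _ hR hS); rewrite ?nonnilE ?size_cat; lia.
pose w := drop p u; have sw : size w = q + r by rewrite size_drop; lia.
have -> : u = take p u ++ take q w ++ drop q w by rewrite !cat_take_drop.
have E1 : take q w ++ take (p' + q' - (p + q)) (drop q w) =
    take (p' - p) w ++ take q' (drop (p' - p) w) by rewrite -!takeD; congr take; lia.
have E2 : drop q w = take (p' + q' - (p + q)) (drop q w) ++ drop (p' + q' - (p + q)) (drop q w).
  by rewrite cat_take_drop.
have := @pumps_crossing R S RF RS p q r p' q' r' M (take p u) _ _ _ _ _ _ M1 _ _ hR hS _ _ _ _ _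
  _ E1 E2.
apply; rewrite ?nonnilE ?size_cat ?size_takel ?size_drop ?sw; lia.
Qed.

(** * Nil congruences *)

(** A third letter lets adjacent letters be swapped: the first identity uses a right neighbour, the
    second a left one. *)
Lemma perm_fi R u v : fully_invariant R ->
  R [:: 0; 1; 2] [:: 1; 0; 2] -> R [:: 0; 1; 2] [:: 0; 2; 1] ->
  perm_eq u v -> 2 < size u -> R u v.
Proof.
move=> RF R01 R12.
have swap A x y B : 0 < size (A ++ B) -> R (A ++ x :: y :: B) (A ++ y :: x :: B).
  case: B => [|c B]; last first.
    move=> _; pose f i := if i is 0 then x else if i is 1 then y else c.
    exact: (fi_cat RF A B (fi_rename RF f R01)).
  rewrite cats0; case/lastP: A => // A c _; rewrite -cats1 -!catA /=.
  pose f i := if i is 0 then c else if i is 1 then x else y.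
  exact: (fi_catl RF A (fi_rename RF f R12)).
have front c A x B : 2 < size (c ++ A ++ x :: B) -> R (c ++ A ++ x :: B) (c ++ x :: A ++ B).
  elim: A c => [|y A IHA] c hs; first exact: fi_refl.
  have := IHA (rcons c y); rewrite !cat_rcons => h; apply: (fi_trans RF (h hs)).
  by apply: swap; move: hs; rewrite !size_cat /= ?size_cat /=; lia.
move=> uv su; suff : forall c, 2 < size (c ++ u) -> R (c ++ u) (c ++ v) by move/(_ [::]); exact.
elim: u v uv {su} => [|x u IHu] v uv c hs.
  by move: uv; rewrite perm_sym => /perm_nilP->; apply: fi_refl.
have xv : x \in v by rewrite -(perm_mem uv) mem_head.
case/splitPr: xv uv => A B xuAB; have uv : perm_eq u (A ++ B).
  by rewrite -(perm_cons x) (perm_trans xuAB) // (perm_catCA A [:: x] B).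
have := IHu _ uv (rcons c x); rewrite !cat_rcons => h; apply: (fi_trans RF (h hs)).
by apply: (fi_sym RF); apply: front; move: hs;
  rewrite !size_cat /= (perm_size uv) ?size_cat /= ?size_cat; lia.
Qed.

Lemma perm_size2 (u v : seq nat) : size u <= 2 -> perm_eq u v -> v = u \/ v = rev u.
Proof.
case: u => [|a [|b [|c u]]] //= _ uv.
- by left; apply: perm_small_eq; rewrite // perm_sym.
- by left; apply: perm_small_eq; rewrite // perm_sym.
have := perm_size uv; case: v uv => [|x [|y [|]]] // uv _.
have : x \in [:: a; b] by rewrite (perm_mem uv) !inE eqxx.
have : y \in [:: a; b] by rewrite (perm_mem uv) !inE eqxx orbT.
have : a \in [:: x; y] by rewrite -(perm_mem uv) !inE eqxx.
have : b \in [:: x; y] by rewrite -(perm_mem uv) !inE eqxx orbT.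
rewrite !inE => hb ha /orP[] /eqP ey /orP[] /eqP ex; subst x y; [|by right|by left|].
  by move: hb; rewrite orbb => /eqP->; left.
by move: ha; rewrite orbb => /eqP->; left.
Qed.

Inductive joined (R S : seq nat -> seq nat -> Prop) : seq nat -> seq nat -> Prop :=
| joined_refl w : joined R S w w
| joined_step u v w : R u v \/ S u v -> joined R S v w -> joined R S u w.

Lemma joined_trans R S v u w : joined R S u v -> joined R S v w -> joined R S u w.
Proof. by elim=> // {}u u' {}v h _ IH /IH; apply: joined_step. Qed.

Lemma joined1 R S u v : R u v \/ S u v -> joined R S u v.
Proof. by move=> h; apply: joined_step h (joined_refl _ _ _). Qed.

Lemma joinedF R S : fully_invariant R -> fully_invariant S -> fully_invariant (joined R S).
Proof.
move=> RF SF; split.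
- exact: joined_refl.
- move=> u v; elim=> [w|{}u {}v w h _ IH]; first exact: joined_refl.
  by apply: joined_trans IH (joined1 _); case: h => h; [left|right]; apply: fi_sym.
- by move=> v u w; apply: joined_trans.
- move=> a b u v; elim=> [w|{}u {}v w h _]; first exact: joined_refl.
  by apply: joined_step; case: h => h; [left|right]; apply: fi_cat.
- move=> z u v nz; elim=> [w|{}u {}v w h _]; first exact: joined_refl.
  by apply: joined_step; case: h => h; [left|right]; apply: fi_subst.
Qed.

Lemma joined_sub R S T : fully_invariant T -> (forall u v, R u v -> T u v) ->
  (forall u v, S u v -> T u v) -> forall u v, joined R S u v -> T u v.
Proof.
move=> TF RT ST u v; elim=> [w|{}u {}v w h _]; first exact: fi_refl.
by apply: (fi_trans TF); case: h; [apply: RT|apply: ST].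
Qed.

Lemma joined_leave R S (P : seq nat -> bool) u v : joined R S u v -> P u -> ~~ P v ->
  exists w w', [/\ P w, ~~ P w' & R w w' \/ S w w'].
Proof.
elim=> [w -> //|{}u {}v w h _ IH Pu Pw]; have [Pv|Pv] := boolP (P v); first exact: IH.
by exists u, v.
Qed.

Definition reflects_nil (R : seq nat -> seq nat -> Prop) := forall w, R [::] w -> w = [::].

Lemma pumps_of_nonperm R u w : fully_invariant R -> u != [::] -> uniq u -> R u w ->
  ~~ perm_eq u w -> pumps_somewhere R (size u).
Proof.
move=> RF nu uu Ruw nuw; pose f i := index i u.
have fu : map f u = iota 0 (size u).
  apply: (@eq_from_nth _ 0); rewrite ?size_map ?size_iota // => i iu.
  by rewrite (nth_map 0) // nth_iota // /f index_uniq.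
apply: (@pumps_of_identity R (size u) (map f w)) => //; first by rewrite -nonnilE.
  by rewrite -fu; apply: fi_rename.
apply: contra nuw => fw.
have wu : {subset w <= u}.
  move=> i iw; have : f i \in map f w by apply: map_f.
  by rewrite (perm_mem fw) mem_iota /f add0n index_mem.
have inj : {in u, cancel f (nth 0 u)} by move=> i iu; rewrite /f nth_index.
have e : map (nth 0 u) (map f w) = w.
  by rewrite -map_comp -[RHS]map_id; apply/eq_in_map => i /wu /inj.
rewrite -{1}(mkseq_nth 0 u) -e perm_sym; exact: perm_map.
Qed.

Section Nil.
Variable (Q : seq nat -> seq nat -> Prop).
Hypotheses (QF : fully_invariant Q) (Qnil : reflects_nil Q).
Hypotheses (Q01 : Q [:: 0; 1; 2] [:: 1; 0; 2]) (Q12 : Q [:: 0; 1; 2] [:: 0; 2; 1]).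
Hypotheses (Q0 : Q [:: 2; 0; 0; 1] [:: 0; 0; 1; 2]) (Q0' : Q [:: 0; 0; 1; 2] [:: 0; 0; 1]).

Definition zero w := Q [:: 0; 0; 1] w.

Lemma zero_absorb x y s : Q ([:: x; x; y] ++ s) [:: x; x; y] /\ Q (s ++ [:: x; x; y]) [:: x; x; y].
Proof.
have h t : Q [:: x; x; y; t] [:: x; x; y] /\ Q [:: t; x; x; y] [:: x; x; y].
  pose f i := if i is 0 then x else if i is 1 then y else t.
  have h := fi_rename QF f Q0'; split => //.
  by apply: (fi_trans QF _ h); apply: (fi_rename QF f Q0).
split; last elim: s => [|t s IHs]; try exact: fi_refl.
  elim/last_ind: s => [|s t IHs]; first exact: fi_refl.
  have [ht _] := h t; rewrite -cats1 catA; apply: (fi_trans QF _ ht).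
  exact: fi_catr IHs.
by have [_ ht] := h t; apply: (fi_trans QF _ ht); apply: (fi_catl QF [:: t]).
Qed.

Lemma zero_xxy x y : zero [:: x; x; y].
Proof.
have [h _] := zero_absorb 0 1 [:: x; x; y]; have [_ h'] := zero_absorb x y [:: 0; 0; 1].
by apply: (fi_trans QF (fi_sym QF h)).
Qed.

Lemma zero_trans u v : zero u -> Q u v -> zero v.
Proof. exact: fi_trans. Qed.

Lemma zero_eq u v : zero u -> zero v -> Q u v.
Proof. by move=> /(fi_sym QF); apply: fi_trans. Qed.

Lemma zero_long w : long_nonlinear w -> zero w.
Proof.
case/andP=> sw nuw.
have [i [s wi]] : exists i s, perm_eq ([:: i; i] ++ s) w.
  elim: w nuw {sw} => //= x w IHw; rewrite negb_and negbK => /orP[xw|/IHw[i [s h]]].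
    case/splitPr: xw => A B; exists x, (A ++ B).
    by rewrite /= perm_cons perm_sym (perm_catCA A [:: x] B).
  by exists i, (x :: s); rewrite (perm_catCA [:: i; i] [:: x] s) /= perm_cons.
apply: zero_trans (perm_fi QF Q01 Q12 wi _); last by rewrite (perm_size wi).
case: s wi => [|y s] wi; first by move: sw; rewrite -(perm_size wi).
have [h _] := zero_absorb i y s; apply: zero_trans (zero_xxy i y) _.
exact: fi_sym h.
Qed.

Lemma zero_cat a w b : zero w -> zero (a ++ w ++ b).
Proof.
move=> zw; have [h _] := zero_absorb 0 1 b; have [_ h'] := zero_absorb 0 1 a.
apply: zero_trans (fi_sym QF h') _; apply: fi_catl => //.
by apply: (fi_trans QF (fi_sym QF h)); apply: fi_catr.
Qed.

Lemma zero_subst z w : nonerasing z -> zero w -> zero (subst z w).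
Proof.
move=> nz zw; apply: zero_trans (fi_subst QF nz zw); apply: zero_long.
rewrite /subst /=; have := nz 0; have := nz 1; case: (z 0) => // x s; case: (z 1) => // y t _ _.
rewrite /long_nonlinear !size_cat /= mem_cat in_cons eqxx orbT /= andbT.
by rewrite ?size_cat /= ?size_cat /=; lia.
Qed.

(* Cubing a letter of [u] that does not occur in [w] makes [u] zero and fixes [w]. *)
Lemma nonzero_subset u w : ~ zero u -> ~ zero w -> Q u w -> {subset u <= w}.
Proof.
move=> nzu nzw Quw x xu; apply/negPn/negP => xw; apply: nzw.
pose z i := if i == x then [:: x; x; x] else [:: i].
have nz : nonerasing z by move=> i; rewrite /z; case: ifP.
have zw : subst z w = w.
  rewrite -[RHS]subst_id; apply: eq_subst => i iw; rewrite /z; case: eqP => // e.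
  by rewrite -e iw in xw.
rewrite -zw; apply: zero_trans (fi_subst QF nz Quw).
case/splitPr: xu => A B; rewrite subst_cat subst_cons {2}/z eqxx.
by apply: zero_cat; apply: zero_xxy.
Qed.

Lemma nonzero_uniq u : ~ zero u -> uniq u \/ exists a, u = [:: a; a].
Proof.
move=> nzu; have [|nu] := boolP (uniq u); [by left|right].
have : ~~ (2 < size u).
  by apply/negP => su; apply: nzu; apply: zero_long; rewrite /long_nonlinear su.
case: u nu {nzu} => [|a [|b [|c u]]] //=; rewrite andbT inE negbK => /eqP<- _.
by exists a.
Qed.

Lemma nonzero_perm u w : ~ zero u -> Q u w -> perm_eq u w.
Proof.
move=> nzu Quw; have nzw : ~ zero w.
  by move=> zw; apply: nzu; apply: zero_trans zw _; apply: fi_sym.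
have uw : u =i w.
  move=> x; apply/idP/idP; first exact: nonzero_subset.
  by apply: nonzero_subset => //; apply: fi_sym.
(* If [aa] is related to [a], it is also related to the zero word [aaaa]. *)
have square a : ~ zero [:: a; a] -> Q [:: a; a] [:: a] -> False.
  move=> nz h; apply: nz; have h4 := fi_cat2 QF h h.
  apply: zero_trans (h4); apply: zero_long; by rewrite /long_nonlinear /= inE eqxx.
case: (nonzero_uniq nzu) (nonzero_uniq nzw) => [uu|[a eu]] [uniw|[b ew]].
- exact: uniq_perm.
- exfalso; apply: (square b); rewrite -ew //; apply: (fi_trans QF (fi_sym QF Quw)).
  have -> : u = [:: b]; last exact: fi_refl.
  by apply: perm_small_eq => //; apply: uniq_perm => // i; rewrite uw ew !inE orbb.
- exfalso; apply: (square a); rewrite -eu //; apply: (fi_trans QF Quw).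
  have -> : w = [:: a]; last exact: fi_refl.
  by apply: perm_small_eq => //; apply: uniq_perm => // i; rewrite -uw eu !inE orbb.
- by have := uw a; rewrite eu ew !inE eqxx => /esym; rewrite orbb => /eqP->.
Qed.

Lemma zero_perm u v : perm_eq u v -> zero u -> zero v.
Proof.
move=> uv zu; have [su|su] := leqP (size u) 2; last by apply: zero_trans zu (perm_fi _ _ _ uv su).
have [->|ev] := perm_size2 su uv; first by [].
case: u su zu {uv} ev => [|a [|b [|c u]]] //= _ zu ev; rewrite ev // /rev /=.
pose f i := if i == a then b else a.
have [ab|ab] := eqVneq b a; first by subst b.
have := zero_subst (z := fun i => [:: f i]) (fun=> isT) zu.
by rewrite subst_single /= /f eqxx (negPf ab).
Qed.

(** * Transfer from one congruence to the other *)

Section Core.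
Variables (P : seq nat -> seq nat -> Prop).
Hypotheses (PQ : forall u v, P u v -> Q u v).
Hypothesis (Pperm : forall u v : seq nat, perm_eq u v -> 2 < size u -> P u v).

(** Nonzero words are [Q]-related only to their permutations, so the step of the chain that leaves
    the permutations of [u] is an [S] step. *)
Lemma leave_pumps S u v : fully_invariant S -> ~ zero u -> u != [::] -> uniq u -> joined P S u v ->
  ~~ perm_eq u v -> pumps_somewhere S (size u).
Proof.
move=> SF nzu nu uu /joined_leave -/(_ (perm_eq u) (perm_refl u)) h /h[w [w' [uw uw' hw]]].
have [eu uniw] : size u = size w /\ uniq w by rewrite -(perm_uniq uw) (perm_size uw).
have {}uw' : ~~ perm_eq w w' by rewrite -(permPl uw).
case: hw => [/PQ Qw|Sw].
  have nzw : ~ zero w by move=> zw; apply: nzu; apply: zero_perm zw; rewrite perm_sym.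
  by rewrite (nonzero_perm nzw Qw) in uw'.
by rewrite eu; apply: pumps_of_nonperm Sw uw' => //; rewrite nonnilE -eu -nonnilE.
Qed.

(** The letters other than [a] go to [aaa] rather than [a], so that only [aa] itself has the image
    [aa]. If the image is [a], squaring leads on to [a^4]. *)
Lemma square_power S a w : fully_invariant S -> S [:: a; a] w -> w != [:: a; a] -> w != [::] ->
  exists2 k, 2 < k & S [:: a; a] (nseq k a).
Proof.
move=> SF Sw wa nw; pose z i := if i == a then [:: a] else [:: a; a; a].
have nz : nonerasing z by move=> i; rewrite /z; case: ifP.
have [k ek] : exists k, subst z w = nseq k a.
  exists (size (subst z w)); apply/all_pred1P/allP => i /mem_subst[j _].
  by rewrite /z; case: ifP => _; rewrite !inE ?orbb.
have := fi_subst SF nz Sw; rewrite {1}/subst /= /z eqxx /= -/z ek => h.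
case: (ltngtP k 2) => [k2|k2|k2]; [|by exists k|].
- have k1 : k = 1.
    have := size_subst w nz; rewrite ek size_nseq; rewrite nonnilE in nw; lia.
  rewrite k1 in h; exists 4 => //; apply: (fi_trans SF h); apply: (fi_trans SF (fi_sym SF h)).
  by have := fi_sym SF (fi_cat2 SF h h).
- move: ek wa; rewrite k2; case: w nw {Sw} => [|x [|y [|t w]]] // _; rewrite !subst_cons.
  + by rewrite /z; case: eqP => //= ->.
  + rewrite {1}/z; case: eqP => [->|//]; rewrite /z; case: eqP => [->|] //=.
    by rewrite eqxx.
  + move=> e; have := size_subst w nz; move/(congr1 size): e; rewrite !size_cat.
    have := nz x; have := nz y; have := nz t; rewrite !nonnilE /=; lia.
Qed.

Lemma square_powers S a k j : fully_invariant S -> S [:: a; a] (nseq k.+2 a) ->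
  S [:: a; a] (nseq (2 + k * j) a).
Proof.
move=> SF h; elim: j => [|j IHj]; first by rewrite muln0; apply: fi_refl.
apply: (fi_trans SF h); have := fi_catr SF (nseq k a) IHj.
by rewrite -nseqD -addnA -mulnSr.
Qed.

Section Transfer.
Variables (R S : seq nat -> seq nat -> Prop).
Hypotheses (RF : fully_invariant R) (SF : fully_invariant S).
Hypotheses (Rnil : reflects_nil R) (Snil : reflects_nil S).
Hypothesis (star : forall u v, zero u -> zero v -> R u v <-> S u v).
Hypothesis (join : forall u v, R u v -> joined P S u v).

(** It suffices to find a zero word [e] related to [u] under both congruences, because [star]
    carries the pair [v], [e] from [R] to [S]. For linear [u] it comes from [pumps_agree], for a
    square from a common exponent. *)
Lemma transfer_zero u v : ~ zero u -> zero v -> R u v -> S u v.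
Proof.
move=> nzu zv Ruv; have [u0|nu] := eqVneq u [::].
  by move: Ruv; rewrite u0 => /Rnil->; apply: fi_refl.
have nuv : ~~ perm_eq u v.
  by apply/negP => uv; apply: nzu; apply: zero_perm zv; rewrite perm_sym.
have [e [ze Re Se]] : exists e, [/\ zero e, R u e & S u e].
  have [uu|[a eu]] := nonzero_uniq nzu.
    have hR := pumps_of_nonperm RF nu uu Ruv nuv.
    have hS := leave_pumps SF nzu nu uu (join Ruv) nuv.
    have [|e [ln Re Se]] := pumps_agree RF SF _ hR hS erefl.
      by move=> x y lx ly; apply: star; apply: zero_long.
    by exists e; split => //; apply: zero_long.
  have [w [wu Sw]] : exists w, w != u /\ S u w.
    have [||x [w [/eqP-> wu [/PQ/(nonzero_perm nzu) Pw|Sw]]]] :=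
      joined_leave (P := pred1 u) (join Ruv).
    - by rewrite /=.
    - by apply: contraNneq nuv => ->.
    - move: wu; have : w = u; last by move->; rewrite /= eqxx.
      rewrite eu in Pw *; have := perm_size Pw; case: w Pw => [|x' [|y []]] // Pw _.
      by have := perm_mem Pw x'; have := perm_mem Pw y;
        rewrite !inE !eqxx !orbT !orbb => /eqP-> /eqP->.
    - by exists w.
  have nw : w != [::].
    by apply: contraNneq nu => w0; rewrite w0 in Sw; rewrite (Snil (fi_sym SF Sw)).
  have nv : v != [::].
    by apply: contraNneq nu => v0; rewrite v0 in Ruv; rewrite (Rnil (fi_sym RF Ruv)).
  have vu : v != u by apply: contraNneq nuv => ->.
  rewrite eu in Ruv Sw vu wu *.
  have [[|[|[|k]]] // _ hk] := square_power RF Ruv vu nv.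
  have [[|[|[|l]]] // _ hl] := square_power SF Sw wu nw.
  (* This exponent is reached from 2 both in steps of [k.+1] and in steps of [l.+1]. *)
  exists (nseq (2 + k.+1 * l.+1) a); split; rewrite ?eu.
  - by apply: zero_long; rewrite /long_nonlinear size_nseq mulSn /= inE eqxx.
  - exact: square_powers.
  - by rewrite mulnC; apply: square_powers.
have : R v e by apply: (fi_trans RF _ Re); apply: fi_sym.
by move/(star zv ze) => Sve; apply: (fi_trans SF Se); apply: fi_sym.
Qed.
End Transfer.

(** If [u] is related to a zero word, the pair is led through it by [transfer_zero]. Otherwise [u]
    and [v] are permutations of each other, of length at most 2 since longer ones are [P]-related,
    and the reversal of a word of two letters is the remaining case. *)
Lemma transfer R S : fully_invariant R -> fully_invariant S -> reflects_nil R -> reflects_nil S ->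
  (forall u v, zero u -> zero v -> R u v <-> S u v) ->
  (forall u v, P u v -> R u v <-> S u v) ->
  (forall u v, R u v -> joined P S u v) -> (forall u v, S u v -> joined P R u v) ->
  forall u v, R u v -> S u v.
Proof.
move=> RF SF Rp Sp star meet RjS SjR u v Ruv.
have [nu|nu] := eqVneq u [::]; first by move: Ruv; rewrite nu => /Rp->; apply: fi_refl.
have nv : v != [::].
  by apply: contraNneq nu => v0; rewrite v0 in Ruv; rewrite (Rp _ (fi_sym RF Ruv)).
have [Puv|nP] := pselect (P u v); first exact/(meet _ _ Puv).
have Rvu := fi_sym RF Ruv.
have toz := transfer_zero RF SF Rp Sp star RjS.
have toz' := transfer_zero SF RF Sp Rp (fun u v zu zv => iff_sym (star u v zu zv)) SjR.
have [zu|nzu] := pselect (zero u).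
  have [zv|nzv] := pselect (zero v); first exact/star.
  by apply: (fi_sym SF); apply: toz.
have [zv|nzv] := pselect (zero v); first exact: toz.
have [[e [ze Rue]]|noz] := pselect (exists e, zero e /\ R u e).
  apply: (fi_trans SF (toz _ _ nzu ze Rue)); apply: (fi_sym SF).
  by apply: toz => //; apply: (fi_trans RF Rvu).
have nonperm_zero T x y : fully_invariant T -> ~ zero x -> x != [::] -> uniq x -> T x y ->
    ~~ perm_eq x y -> exists e, zero e /\ T x e.
  move=> TF nzx nx ux Txy nxy; have hT := pumps_of_nonperm TF nx ux Txy nxy.
  have [//|e [ln Te _]] := pumps_agree TF TF _ hT hT erefl.
  by exists e; split => //; apply: zero_long.
have uv : perm_eq u v.
  apply/negPn/negP => nuv; apply: noz.
  have [uu|[a eu]] := nonzero_uniq nzu; first exact: nonperm_zero Ruv nuv.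
  have [uv|[b ev]] := nonzero_uniq nzv.
    have [|e [ze Rve]] := nonperm_zero R v u RF nzv nv uv Rvu; first by rewrite perm_sym.
    by exists e; split => //; apply: (fi_trans RF Ruv).
  have ab : a != b by apply: contraNneq nuv => ab; rewrite eu ev ab.
  (* Doubling [b] fixes [u = aa] and sends [v = bb] to the zero word [b^4]. *)
  exists (subst (fun i => if i == b then [:: b; b] else [:: i]) v); split.
    by rewrite ev subst_cons subst_cons eqxx; apply: zero_long; rewrite /long_nonlinear /= inE eqxx.
  have -> : u = subst (fun i => if i == b then [:: b; b] else [:: i]) u.
    by rewrite eu !subst_cons (negPf ab).
  by apply: (fi_subst RF) => // i; case: ifP.
have su : size u <= 2 by rewrite leqNgt; apply/negP => /(Pperm uv).
have [->|vu] := eqVneq v u; first exact: fi_refl.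
(* Some step of the chain leaves [u] for a word [w]. A [P] step could only lead to [v], against
   [nP]; if [w] is not a permutation of [u], then [S], and hence [R], relates [u] to a zero word,
   against [noz]. *)
have [_ [w [/eqP-> wu hw]]] := joined_leave (P := pred1 u) (RjS _ _ Ruv) (eqxx u) vu.
have uw_v : perm_eq u w -> w = v.
  move=> uw; have [e|->] := perm_size2 su uv; first by rewrite e eqxx in vu.
  by have [e|->] := perm_size2 su uw; first by rewrite /= e eqxx in wu.
have {}wv : w != v -> ~~ perm_eq u w by move=> wv; apply: contraNN wv => /uw_v->.
have Suw : S u w.
  case: hw => // Puw; case: nP; have := nonzero_perm nzu (PQ Puw).
  by move=> /uw_v e; rewrite -e.
have [wv'|/wv nuw] := eqVneq w v; first by rewrite -wv'.
have [uu|[a eu]] := nonzero_uniq nzu; last first.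
  move: vu; rewrite eu; have [->|->] := perm_size2 su uv; by rewrite eu /rev /= eqxx.
have [e [ze Sue]] := nonperm_zero S u w SF nzu nu uu Suw nuw.
by case: noz; exists e; split => //; apply: toz'.
Qed.
End Core.
End Nil.

(** * Idempotent powers and the content of zero words *)

Lemma fi_idempotent_power R e k : fully_invariant R -> R e (e ++ e) -> 0 < k -> R e (power e k).
Proof.
move=> RF ee; case: k => // k _; elim: k => [|k IHk]; first by rewrite power1; apply: fi_refl.
by apply: (fi_trans RF ee); rewrite powerS; apply: fi_catl.
Qed.

Lemma fi_subst_ext R z z' w : fully_invariant R -> (forall i, R (z i) (z' i)) ->
  R (subst z w) (subst z' w).
Proof.
move=> RF h; elim: w => [|x w IHw]; first exact: fi_refl.
by rewrite !subst_cons; apply: fi_cat2.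
Qed.

(* [(s^o t s^o)^o = s^o]: the idempotent powers are in one archimedean component. *)
Definition archimedean (R : seq nat -> seq nat -> Prop) (o : nat) : Prop :=
  forall s t, s != [::] -> t != [::] ->
    R (power s o) (power (power s o ++ t ++ power s o) o).

(** A letter [x] that occurs only in [q] takes any value without changing the image of [p]. The
    values [s] and [s ++ s], with all other letters sent to [s], make powers periodic; sending the
    others to an idempotent power [e] and [x] to [e t e] gives the law. *)
Lemma archimedean_of_identity R p q : fully_invariant R -> reflects_nil R -> R p q -> ~ p =i q ->
  exists2 K, 0 < K & forall j, 0 < j -> archimedean R (K * j).
Proof.
move=> RF Rp Rpq npq.
wlog [x xq xp] : p q Rpq npq / exists2 x, x \in q & x \notin p.
  move=> WL; have [h|nh] := pselect (exists2 x, x \in q & x \notin p); first exact: (WL p q).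
  apply: (WL q p); [exact: fi_sym|by move=> h; apply: npq => x; rewrite h|].
  apply: contrapT => nh'; apply: npq => x; apply/idP/idP => h; apply/negPn/negP => h'.
    by apply: nh'; exists x.
  by apply: nh; exists x.
have p0 : p != [::].
  by apply/eqP => p0; rewrite p0 in Rpq; rewrite (Rp _ Rpq) in xq.
pose k := size p; have k0 : 0 < k by rewrite -nonnilE.
pose y (s t : seq nat) i := if i == x then t else s.
have Ry s t : s != [::] -> t != [::] -> R (power s k) (subst (y s t) q).
  move=> ns nt; have -> : power s k = subst (y s t) p.
    rewrite -subst_const; apply: eq_subst => i ip; rewrite /y; case: eqP => // e.
    by rewrite -e ip in xp.
  by apply: (fi_subst RF) => // i; rewrite /y; case: ifP.
pose l := size q; pose c := count_mem x q.
have c0 : 0 < c by rewrite -has_count has_pred1.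
have l0 : 0 < l by rewrite /l; case: (q) xq.
have Rl s : s != [::] -> R (power s l) (power s (l + c)).
  move=> ns; have h1 := Ry s s ns ns.
  have h2 := Ry s (s ++ s) ns (_ : s ++ s != [::]).
  have e1 : subst (y s s) q = power s l.
    by rewrite -subst_const; apply: eq_subst => i _; rewrite /y; case: eqP.
  have e2 : subst (y s (s ++ s)) q = power s (l + c).
    rewrite /l /c; elim: (q) => [|i w IHw]; first by rewrite power0.
    rewrite subst_cons /= IHw /y; case: eqP => _; rewrite ?add1n ?add0n addSn ?addnS !powerS //.
    by rewrite catA.
  rewrite e1 in h1; rewrite e2 in h2; apply: (fi_trans RF (fi_sym RF h1)); apply: h2.
  by rewrite nonnilE size_cat; rewrite nonnilE in ns; lia.
have Rli s i j : s != [::] -> R (power s (l + i)) (power s (l + i + j * c)).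
  move=> ns; elim: j => [|j IHj]; first by rewrite addn0; apply: fi_refl.
  apply: (fi_trans RF IHj); have := fi_catr RF (power s (i + j * c)) (Rl s ns).
  by rewrite -!powerD; congr (R (power s _) (power s _)); lia.
(* A multiple of the period [c] that is at least [l] is an idempotent exponent. Admitting all
   multiples [K * j] lets two congruences share one exponent. *)
exists (c * l); first by rewrite muln_gt0 c0.
move=> j j0 s t ns nt; set o := c * l * j; set e := power s o.
have lo : l <= o by rewrite /o mulnAC leq_pmull // muln_gt0 c0.
have o0 : 0 < o by exact: leq_trans l0 lo.
have ee : R e (e ++ e).
  rewrite /e -powerD -{1 2}(subnKC lo).
  have {3}-> : o = l * j * c by rewrite /o -mulnA mulnC.
  exact: Rli.
have ne : e != [::] by rewrite nonnilE size_power muln_gt0 o0 -nonnilE.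
set T := e ++ t ++ e.
have eT : R (e ++ T) T by rewrite /T catA; apply: fi_catr => //; apply: fi_sym.
have Te : R (T ++ e) T by rewrite /T -!catA; apply: fi_catl => //; apply: fi_catl => //;
  apply: fi_sym.
have nT : T != [::] by rewrite nonnilE size_cat; rewrite nonnilE in ne; lia.
have lT w : R (subst (y e T) w ++ T) (power T (count_mem x w).+1).
  elim: w => [|i w IHw]; first by rewrite /= power1; apply: fi_refl.
  rewrite subst_cons -catA /= {1}/y; apply: (fi_trans RF (fi_catl RF _ IHw)).
  case: eqP => _; rewrite ?add0n ?add1n -?powerS; first exact: fi_refl.
  by rewrite powerS catA; apply: fi_catr.
have Tr w : R (T ++ subst (y e T) w) (power T (count_mem x w).+1).
  elim/last_ind: w => [|w i IHw]; first by rewrite /= cats0 power1; apply: fi_refl.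
  rewrite -cats1 subst_cat subst_cons cats0 count_cat /= addn0 catA {2}/y.
  apply: (fi_trans RF (fi_catr RF _ IHw)).
  case: eqP => _; rewrite ?addn0 ?addn1 -?powerSr; first exact: fi_refl.
  by rewrite powerSr -catA; apply: fi_catl.
(* In the image of [q] each [e] is absorbed by a neighbouring [T], and one [T] remains for each of
   the [c] occurrences of [x]. *)
have eTc : R e (power T c).
  apply: (fi_trans RF (fi_idempotent_power RF ee k0)); apply: (fi_trans RF (Ry e T ne nT)).
  rewrite /c; case/splitPr: xq => A B; rewrite subst_cat subst_cons {2}/y eqxx.
  rewrite count_cat /= eqxx add1n addnS -addSn powerD.
  apply: (fi_trans RF (fi_catl RF _ (Tr B))); rewrite powerS catA.
  exact: fi_catr.
apply: (fi_trans RF (fi_idempotent_power RF ee (_ : 0 < l * j))); first by rewrite muln_gt0 l0.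
have -> : power T o = power (power T c) (l * j) by rewrite -powerM mulnA.
exact: fi_power.
Qed.

Section Star.
Variable (Q : seq nat -> seq nat -> Prop).
Hypotheses (QF : fully_invariant Q) (Qnil : reflects_nil Q).
Hypotheses (Q01 : Q [:: 0; 1; 2] [:: 1; 0; 2]) (Q12 : Q [:: 0; 1; 2] [:: 0; 2; 1]).
Hypotheses (Q0 : Q [:: 2; 0; 0; 1] [:: 0; 0; 1; 2]) (Q0' : Q [:: 0; 0; 1; 2] [:: 0; 0; 1]).
Let zero := zero Q.

(** Sending every letter outside [u] to [u^o] fixes [u] and gives [v] the content of [u], so that
    [same] applies. By the archimedean law both congruences then allow [u^o] to be replaced by
    [(u^o i u^o)^o], which restores the letters [i] of [v]. *)
Lemma zero_extend R S o u v : fully_invariant R -> fully_invariant S -> 0 < o ->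
  archimedean R o -> archimedean S o ->
  (forall u v, zero u -> zero v -> u =i v -> R u v -> S u v) ->
  zero u -> zero v -> R u v -> exists w, [/\ w =i u ++ v, zero w, R u w & S u w].
Proof.
move=> RF SF o0 Ro So same zu zv Ruv.
have [vu|] := boolP (all (mem u) v).
  exists u; split => //; try exact: fi_refl.
  by move=> i; rewrite mem_cat; case: (boolP (i \in v)) => [/(allP vu) /= iu|_];
    rewrite ?orbT ?orbF.
case/allPn=> b bv bu; have {}bu : b \notin u by [].
have nu : u != [::].
  by apply/eqP => u0; move: zu; rewrite u0 => /(fi_sym QF)/Qnil.
pose z1 i := if i \in u then [:: i] else power u o.
pose z2 i := if i \in u then [:: i] else power (power u o ++ [:: i] ++ power u o) o.
have npow s : s != [::] -> power s o != [::] by move=> ns;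
  rewrite nonnilE size_power muln_gt0 o0 -nonnilE.
have nz1 : nonerasing z1 by move=> i; rewrite /z1; case: ifP => // _; apply: npow.
have nz2 : nonerasing z2.
  move=> i; rewrite /z2; case: ifP => // _; apply: npow.
  by rewrite nonnilE !size_cat /=; lia.
have mempow s i : (i \in power s o) = (i \in s).
  by rewrite -(prednK o0); elim: o.-1 => [|n IHn]; rewrite ?power1 // powerS mem_cat IHn orbb.
have Ru1 : R u (subst z1 v).
  have := fi_subst RF nz1 Ruv; have -> // : subst z1 u = u.
  by rewrite -[RHS]subst_id; apply: eq_subst => i iu; rewrite /z1 iu.
have z1u : u =i subst z1 v.
  move=> i; apply/idP/mem_subst => [iu|[j jv]]; last first.
    by rewrite /z1; case: ifP; rewrite ?inE ?mempow // => ju /eqP->.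
  by exists b => //; rewrite /z1 (negPf bu) mempow.
have z1z : zero (subst z1 v) by apply: zero_subst.
have Su1 : S u (subst z1 v) by apply: same.
have h12 T : fully_invariant T -> archimedean T o -> T (subst z1 v) (subst z2 v).
  move=> TF To; apply: fi_subst_ext => // i; rewrite /z1 /z2; case: ifP => _; first exact: fi_refl.
  exact: To.
exists (subst z2 v); split.
- move=> i; rewrite mem_cat; apply/mem_subst/orP => [[j jv]|].
    rewrite /z2; case: ifP; rewrite ?inE ?mempow ?mem_cat ?mempow ?inE => ju.
      by move=> /eqP->; left.
    by rewrite orbC -orbA orbb => /orP[/eqP->|]; [right|left].
  case: (boolP (i \in u)) => [iu _|iu [//|iv]]; last first.
    by exists i => //; rewrite /z2 (negPf iu) mempow !mem_cat inE eqxx orbT.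
  by exists b => //; rewrite /z2 (negPf bu) mempow mem_cat mempow iu.
- exact: zero_subst.
- by apply: (fi_trans RF Ru1); apply: h12.
- by apply: (fi_trans SF Su1); apply: h12.
Qed.

Lemma zero_transfer P R S : (forall u v : seq nat, P u v <-> Q u v /\ u =i v) ->
  fully_invariant R -> fully_invariant S -> reflects_nil R -> reflects_nil S ->
  (forall u v, P u v -> R u v <-> S u v) ->
  (forall u v, R u v -> joined P S u v) -> (forall u v, S u v -> joined P R u v) ->
  forall u v, zero u -> zero v -> R u v -> S u v.
Proof.
move=> PE RF SF Rp Sp meet RjS SjR u v zu zv Ruv.
have zP x y : zero x -> zero y -> x =i y -> P x y by move=> zx zy xy; apply/PE; split => //;
  apply: zero_eq.
have [uv|nuv] := pselect (u =i v); first by apply/(meet _ _ (zP _ _ zu zv uv)).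
have [K K0 aK] := archimedean_of_identity RF Rp Ruv nuv.
(* The chain of [P] and [S] steps from [u] to [v] changes the content, and [P] steps do not. *)
have [p [q [Spq npq]]] : exists p q, S p q /\ ~ p =i q.
  apply: contrapT => nS; apply: nuv.
  elim: (RjS _ _ Ruv) => // x y w h _ IH i; rewrite -IH.
  case: h => [/PE[_ ->]//|Sxy]; apply: contrapT => ni; apply: nS.
  by exists x, y; split => // h; apply: ni; rewrite h.
have [K' K'0 aK'] := archimedean_of_identity SF Sp Spq npq.
have aR := aK K' K'0; have := aK' K K0; rewrite mulnC => aS.
have o0 : 0 < K * K' by rewrite muln_gt0 K0.
have same x y : zero x -> zero y -> x =i y -> R x y -> S x y.
  by move=> zx zy xy Rxy; apply/(meet _ _ (zP _ _ zx zy xy)).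
have [w [wuv zw Ruw Suw]] := zero_extend RF SF o0 aR aS same zu zv Ruv.
have [w' [wuv' zw' Rvw Svw]] := zero_extend RF SF o0 aR aS same zv zu (fi_sym RF Ruv).
apply: (fi_trans SF Suw); apply: (fi_trans SF) (fi_sym SF Svw).
apply: same => //; first by move=> i; rewrite wuv wuv' !mem_cat orbC.
by apply: (fi_trans RF (fi_sym RF Ruw)); apply: (fi_trans RF Ruv).
Qed.
End Star.

(** * Varieties and fully invariant congruences *)

Definition mkword (w : seq nat) : word := (head 0 w, behead w).

Lemma lettersK (u : word) : mkword (letters u) = u.
Proof. by case: u. Qed.

Lemma mkwordK w : w != [::] -> letters (mkword w) = w.
Proof. by case: w. Qed.

Lemma mkword_cat u v : u != [::] -> v != [::] -> mkword (u ++ v) = mkword u ⋅ mkword v.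
Proof. by case: u => // x s _; case: v. Qed.

Lemma eval_subst (S : semigroup) (phi : nat -> S) z w : nonerasing z -> w != [::] ->
  eval phi (mkword (subst z w)) = eval (fun i => eval phi (mkword (z i))) (mkword w).
Proof.
move=> nz; elim: w => // x [|y w] IHw _; first by rewrite /subst /= cats0.
rewrite subst_cons mkword_cat ?subst_nil // eval_concat IHw //.
by rewrite (mkword_cat (u := [:: x]) (v := y :: w)) // eval_concat.
Qed.

(* The identities of a variety, with the empty word added as a class of its own. *)
Definition eqv (V : variety) (u v : seq nat) : Prop :=
  (u == [::]) = (v == [::]) /\ satisfies V (mkword u ≈ mkword v).

Lemma eqv_nil V : reflects_nil (eqv V).
Proof. by move=> w [/esym]; rewrite eqxx => /eqP. Qed.

Lemma eqvE V (u v : word) : eqv V (letters u) (letters v) <-> satisfies V (u ≈ v).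
Proof. by rewrite /eqv !lettersK; split=> [[]|]. Qed.

Lemma eqvF V : fully_invariant (eqv V).
Proof.
split.
- by move=> w; split.
- by move=> u v [e h]; split=> // S VS phi; rewrite /= (h S VS phi).
- move=> v u w [e h] [e' h']; split; first by rewrite e.
  by move=> S VS phi; have := h S VS phi; have := h' S VS phi => /= <-.
- move=> a b u v [e h]; have [u0|nu] := eqVneq u [::].
    by move: e; rewrite u0 eqxx => /esym/eqP->; split.
  have nv : v != [::] by rewrite -e.
  have hr : eqv V (u ++ b) (v ++ b).
    have [->|nb] := eqVneq b [::]; first by rewrite !cats0; split.
    split; first by rewrite -!size_eq0 !size_cat !addn_eq0 !size_eq0 (negPf nu) (negPf nv).
    by move=> S VS phi; rewrite /= !mkword_cat // !eval_concat; have /= -> := h S VS phi.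
  have [->|na] := eqVneq a [::]; first by [].
  have nub : u ++ b != [::] by case: (u) nu.
  have nvb : v ++ b != [::] by case: (v) nv.
  split; first by case: (a) na.
  by move=> S VS phi; rewrite /= !(mkword_cat na) // !eval_concat; have /= -> := hr.2 S VS phi.
- move=> z u v nz [e h]; split; first by rewrite !subst_nil.
  have [u0|nu] := eqVneq u [::].
    by move: e; rewrite u0 eqxx => /esym/eqP->.
  have nv : v != [::] by rewrite -e.
  by move=> S VS phi; rewrite /= !eval_subst //; apply: (h S VS).
Qed.

(** * Relatively free semigroups *)

Section FreeSemigroup.
Variables (R : seq nat -> seq nat -> Prop) (RF : fully_invariant R) (Rnil : reflects_nil R).

Let repr (w : seq nat) : seq nat := xget [::] [set u | R w u]%classic.

Lemma reprP w : R w (repr w).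
Proof. by rewrite /repr; case: xgetP => [u -> //|/(_ w)]; case; apply: fi_refl. Qed.

Lemma repr_eq u v : R u v -> repr u = repr v.
Proof.
move=> Ruv; rewrite /repr; congr xget; apply/funext => w; apply/propext; split => h /=.
  by apply: (fi_trans RF) h; apply: fi_sym.
exact: (fi_trans RF) h.
Qed.

Lemma repr_nonnil w : w != [::] -> repr w != [::].
Proof.
apply: contraNneq => e; have := fi_sym RF (reprP w).
by rewrite e => /Rnil->.
Qed.

(** The quotient of the nonempty words by [R], realized by the class representatives that [xget]
    chooses. *)
Definition free_carrier := {w : seq nat | w != [::] /\ repr w = w}.

Lemma free_subproof w : w != [::] -> repr w != [::] /\ repr (repr w) = repr w.
Proof. by move=> nw; split; [apply: repr_nonnil|rewrite -(repr_eq (reprP w))]. Qed.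

Definition free_elt w (nw : w != [::]) : free_carrier := exist _ (repr w) (free_subproof nw).

Lemma free_carrier_eq (x y : free_carrier) : sval x = sval y -> x = y.
Proof. by case: x y => [x hx] [y hy] /= e; subst y; rewrite (Prop_irrelevance hx hy). Qed.

Lemma cat_nonnil (x y : free_carrier) : sval x ++ sval y != [::].
Proof. by case: x => [[|a s] []]. Qed.

Definition free_mul (x y : free_carrier) : free_carrier := free_elt (cat_nonnil x y).

Lemma free_mulA : associative free_mul.
Proof.
move=> x y z; apply: free_carrier_eq; apply: repr_eq.
have h1 : R (sval x ++ sval y ++ sval z) (sval x ++ sval (free_mul y z)).
  by apply: fi_catl => //; apply: reprP.
have h2 : R ((sval x ++ sval y) ++ sval z) (sval (free_mul x y) ++ sval z).
  by apply: fi_catr => //; apply: reprP.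
by apply: (fi_trans RF (fi_sym RF h1)); rewrite catA.
Qed.

Definition free_semigroup : semigroup :=
  BuildSemigroup free_mulA (inhabits (free_elt (isT : [:: 0] != [::]))).

Lemma eval_free (phi : nat -> free_semigroup) w : w != [::] ->
  sval (eval phi (mkword w)) = repr (subst (fun i => sval (phi i)) w).
Proof.
elim: w => // x [|y w] IHw _.
  by rewrite subst_cons cats0 /eval /=; case: (phi x) => s [].
rewrite (mkword_cat (u := [:: x]) (v := y :: w)) // eval_concat /= IHw //.
by rewrite subst_cons; apply: repr_eq; apply: fi_catl => //; apply: (fi_sym RF); apply: reprP.
Qed.

Lemma free_holds u v : u != [::] -> v != [::] ->
  holds_in free_semigroup (mkword u ≈ mkword v) <-> R u v.
Proof.
move=> nu nv; split=> [h|Ruv phi]; last first.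
  apply: free_carrier_eq; rewrite /= !eval_free //; apply: repr_eq; apply: fi_subst => // i.
  by case: (phi i) => s [].
have := congr1 sval (h (fun i => free_elt (isT : [:: i] != [::]))).
rewrite /= !eval_free // => e.
have key w : R w (repr (subst (fun i => repr [:: i]) w)).
  apply: (fi_trans RF) (reprP _); rewrite -{1}(subst_id w).
  elim: w => [|x w IHw]; first exact: fi_refl.
  by rewrite !subst_cons; apply: fi_cat2 => //; apply: reprP.
by apply: (fi_trans RF (key u)); rewrite /= in e; rewrite e; apply: (fi_sym RF).
Qed.

End FreeSemigroup.

Definition variety_of_fi (R : seq nat -> seq nat -> Prop) : variety :=
  variety_of [set e | R (letters e.1) (letters e.2)]%classic.

(** Birkhoff completeness: [free_semigroup] is a member of the variety, and its identities are
    exactly those of [R]. *)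
Lemma eqv_variety_of R : fully_invariant R -> reflects_nil R ->
  forall u v, eqv (variety_of_fi R) u v <-> R u v.
Proof.
move=> RF Rnil u v; split=> [[e h]|Ruv].
  have [u0|nu] := eqVneq u [::].
    by move: e; rewrite u0 eqxx => /esym/eqP->; apply: fi_refl.
  have nv : v != [::] by rewrite -e.
  apply/(free_holds RF Rnil nu nv); apply: h => -[x y] /= hxy.
  by have /(free_holds RF Rnil) := hxy; rewrite !lettersK; apply.
have e : (u == [::]) = (v == [::]).
  by apply/eqP/eqP => e; rewrite e in Ruv; [exact: Rnil|apply: Rnil; exact: fi_sym].
split=> // S hS; have [u0|nu] := eqVneq u [::].
  by move: e; rewrite u0 eqxx => /esym/eqP->.
have nv : v != [::] by rewrite -e.
by apply: (hS (mkword u ≈ mkword v)); rewrite /= !mkwordK.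
Qed.

Lemma variety_sub (X Y : variety) : (forall u v, eqv X u v -> eqv Y u v) ->
  forall S, members Y S -> members X S.
Proof.
move=> XY S YS; have [Sigma eX] := varietyP X; rewrite eX => -[u v] uv.
have /eqvE/XY/eqvE h : satisfies X (u ≈ v) by move=> T; rewrite eX; apply.
exact: h.
Qed.

Lemma variety_ext (X Y : variety) : (forall u v, eqv X u v <-> eqv Y u v) -> X = Y.
Proof.
move=> XY; apply: variety_eq; apply/funext => S; apply/propext.
by split; apply: variety_sub => u v /XY.
Qed.

Lemma joinE (X Y : variety) : (X `|` Y)%O = variety_join X Y.
Proof. by []. Qed.

Lemma meetE (X Y : variety) : (X `&` Y)%O = variety_meet X Y.
Proof. by []. Qed.

Lemma eqv_join (X Y : variety) u v : eqv (X `|` Y)%O u v <-> eqv X u v /\ eqv Y u v.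
Proof.
rewrite joinE; split=> [[e h]|[[e h] [_ h']]].
  by split; split=> // S XS; apply: h => -[x y] [hx hy]; [apply: hx|apply: hy].
by split=> // S hS; apply: (hS (mkword u ≈ mkword v)).
Qed.

(** From left to right: [joined] is itself fully invariant and defines a variety contained in both
    [X] and [Y], where every identity of the meet must hold. *)
Lemma eqv_meet (X Y : variety) u v : eqv (X `&` Y)%O u v <-> joined (eqv X) (eqv Y) u v.
Proof.
rewrite meetE; split; last first.
  apply: joined_sub => [|{}u {}v [e h]|{}u {}v [e h]]; first exact: eqvF.
    by split=> // S [XS _]; apply: h.
  by split=> // S [_ YS]; apply: h.
pose R := joined (eqv X) (eqv Y).
have RF : fully_invariant R by apply: joinedF; apply: eqvF.
have Rnil : reflects_nil R.
  suff nil x w : R x w -> x = [::] -> w = [::] by move=> w /nil; apply.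
  by elim=> // {}x y {}w h _ IH x0; apply: IH; rewrite x0 in h; case: h => /eqv_nil.
have sub Z : (forall u v, eqv Z u v -> R u v) -> forall S,
  members (variety_of_fi R) S -> members Z S.
  by move=> ZR; apply: variety_sub => x y /ZR /(eqv_variety_of RF Rnil).
move=> [e h]; apply/(eqv_variety_of RF Rnil); split=> // S RS; apply: h; split;
  apply: sub RS => x y xy.
  by apply: joined1; left.
by apply: joined1; right.
Qed.

(** * Sufficiency *)

Lemma eqv_trivial u v : eqv trivial_variety u v <-> (u == [::]) = (v == [::]).
Proof.
split=> [[]//|e]; split=> // S hS phi.
by have /= := hS _ erefl (fun i => if i is 0 then eval phi (mkword u) else eval phi (mkword v)).
Qed.

Definition bool_semilattice : semigroup := BuildSemigroup andbA (inhabits true).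

Lemma eval_bool (phi : nat -> bool_semilattice) w : w != [::] ->
  eval phi (mkword w) = all phi w.
Proof.
elim: w => // x [|y w] IHw _; first by rewrite /= andbT.
by rewrite (mkword_cat (u := [:: x]) (v := y :: w)) // eval_concat IHw.
Qed.

Lemma eqv_semilattice u v : eqv semilattice_variety u v <-> u =i v.
Proof.
set R := eqv _; have RF : fully_invariant R by apply: eqvF.
split=> [[e h]|uv].
  have [u0|nu] := eqVneq u [::].
    by move: e; rewrite u0 eqxx => /esym/eqP->.
  have nv : v != [::] by rewrite -e.
  move=> x; have hb : members semilattice_variety bool_semilattice.
    by move=> _ [] -> phi; [exact: andbb|exact: andbC].
  have := h _ hb (fun i => i != x); rewrite /= !eval_bool //.
  by rewrite !all_predC !has_pred1 => /negb_inj.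
have h0 : R [:: 0; 0] [:: 0] 
  by apply: (proj2 (eqvE _ (letter 0 ⋅ letter 0) (letter 0))) => S hS; apply: hS; left.
have h1 : R [:: 0; 1] [:: 1; 0].
  apply: (proj2 (eqvE _ (letter 0 ⋅ letter 1) (letter 1 ⋅ letter 0))) => S hS.
  by apply: hS; right.
have comm s t : R (s ++ t) (t ++ s).
  have [->|ns] := eqVneq s [::]; first by rewrite cats0; apply: fi_refl.
  have [->|nt] := eqVneq t [::]; first by rewrite cats0; apply: fi_refl.
  have nz : nonerasing (fun i => if i is 0 then s else t) by case.
  by have := fi_subst RF nz h1; rewrite /subst /= !cats0.
have absorb1 w x : x \in w -> R (w ++ [:: x]) w.
  case/splitPr=> A B; rewrite -catA /=; apply: fi_catl => //.
  apply: (fi_trans RF (comm (x :: B) [:: x])).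
  exact: (fi_catr RF B (fi_rename RF (fun=> x) h0)).
have absorb w s : {subset s <= w} -> R (w ++ s) w.
  elim/last_ind: s => [|s x IHs] sw; first by rewrite cats0; apply: fi_refl.
  rewrite -cats1 catA; apply: (fi_trans RF) (absorb1 w x _).
    by apply: fi_catr => //; apply: IHs => i si; apply: sw; rewrite mem_rcons inE si orbT.
  by apply: sw; rewrite mem_rcons mem_head.
apply: (fi_trans RF (fi_sym RF (absorb u v _))) => [i|]; first by rewrite uv.
by apply: (fi_trans RF (comm u v)); apply: absorb => i; rewrite uv.
Qed.

Lemma cancellable_of_decomposition (V M N : variety) :
  M = trivial_variety \/ M = semilattice_variety ->
  eqv N [:: 0; 1; 2] [:: 1; 0; 2] -> eqv N [:: 0; 1; 2] [:: 0; 2; 1] ->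
  eqv N [:: 2; 0; 0; 1] [:: 0; 0; 1; 2] -> eqv N [:: 0; 0; 1; 2] [:: 0; 0; 1] ->
  V = (M `|` N)%O -> cancellable V.
Proof.
move=> hM N01 N12 N0 N0' eV; pose Q := eqv N; pose P := eqv V.
have QF : fully_invariant Q by apply: eqvF.
have Qnil : reflects_nil Q by apply: eqv_nil.
have PQ u v : P u v -> Q u v by rewrite /P eV => /eqv_join[].
have Pperm u v : perm_eq u v -> 2 < size u -> P u v.
  move=> uv su; rewrite /P eV; apply/eqv_join; split; last exact: perm_fi.
  case: hM => ->; last by apply/eqv_semilattice; apply: perm_mem.
  by apply/eqv_trivial; rewrite -!size_eq0 (perm_size uv).
suff key Y Z : (forall u v, P u v -> eqv Y u v <-> eqv Z u v) ->
    (forall u v, joined P (eqv Y) u v <-> joined P (eqv Z) u v) ->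
    forall u v, eqv Y u v -> eqv Z u v.
  move=> Y Z ej em; have hj u v : P u v -> eqv Y u v <-> eqv Z u v.
    move=> Puv; have := eqv_join V Y u v; rewrite ej => -[h h'].
    have [g g'] := eqv_join V Z u v; split=> [hY|hZ].
      by have [] := g (h' (conj Puv hY)).
    by have [] := h (g' (conj Puv hZ)).
  have hm u v : joined P (eqv Y) u v <-> joined P (eqv Z) u v.
    by apply: (iff_trans (iff_sym (eqv_meet V Y u v))); rewrite em; exact: eqv_meet.
  by apply: variety_ext => u v; split; apply: key => // x y; [move=> /hj|]; apply: iff_sym.
move=> hj hm u v; have YF := eqvF Y; have ZF := eqvF Z.
have YjZ x y : eqv Y x y -> joined P (eqv Z) x y by move=> h; apply/hm; apply: joined1; right.
have ZjY x y : eqv Z x y -> joined P (eqv Y) x y by move=> h; apply/hm; apply: joined1; right.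
apply: (transfer QF N01 N12 N0 N0' PQ Pperm YF ZF (@eqv_nil _) (@eqv_nil _) _ hj YjZ ZjY).
(* For [M = T] all zero words are [P]-related and [hj] decides; for [M = SL] only those of equal
   content are. *)
move=> {}u {}v zu zv; case: hM => eM.
  apply: hj; rewrite /P eV eM; apply/eqv_join; have Quv : Q u v by apply: zero_eq zu zv.
  by split => //; apply/eqv_trivial; case: Quv.
have PE x y : P x y <-> Q x y /\ x =i y.
  rewrite /P eV eM; apply: (iff_trans (eqv_join _ _ _ _)).
  by split=> [[/eqv_semilattice ? ?]|[? /eqv_semilattice ?]].
have hj' x y : P x y -> eqv Z x y <-> eqv Y x y by move=> /hj; apply: iff_sym.
by split; apply: (zero_transfer QF Qnil N01 N12 N0 N0' PE) => //; apply: eqv_nil.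
Qed.

(** * Necessity *)

(** The premise on [T] expresses, by its universal property, that [R] and [S] have the same join
    with [eqv V], that is, that the variety meets coincide. *)
Lemma cancellable_fi (V : variety) R S : cancellable V ->
  fully_invariant R -> fully_invariant S -> reflects_nil R -> reflects_nil S ->
  (forall u v, eqv V u v -> R u v <-> S u v) ->
  (forall T, fully_invariant T -> (forall u v, eqv V u v -> T u v) ->
     (forall u v, R u v -> T u v) <-> (forall u v, S u v -> T u v)) ->
  forall u v, R u v -> S u v.
Proof.
move=> cV RF SF Rnil Snil meet join u v; pose Y := variety_of_fi R; pose Z := variety_of_fi S.
have YE := eqv_variety_of RF Rnil; have ZE := eqv_variety_of SF Snil.
suff eYZ : Y = Z by move/YE; rewrite -/Y eYZ => /ZE.
apply: cV; apply: variety_ext => x y.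
  split=> /eqv_join[Vxy h]; apply/eqv_join; split=> //.
    by apply/ZE/(meet _ _ Vxy)/YE.
  by apply/YE/(meet _ _ Vxy)/ZE.
split=> /eqv_meet h; apply/eqv_meet; apply: joined_sub h; try by apply: joinedF => //; apply: eqvF.
- by move=> a b h; apply: joined1; left.
- move=> a b /YE; move: a b; apply/(join (joined (eqv V) (eqv Z))).
  + by apply: joinedF => //; apply: eqvF.
  + by move=> a b h; apply: joined1; left.
  + by move=> a b h; apply: joined1; right; apply/ZE.
- by move=> a b h; apply: joined1; left.
- move=> a b /ZE; move: a b; apply/(join (joined (eqv V) (eqv Y))).
  + by apply: joinedF => //; apply: eqvF.
  + by move=> a b h; apply: joined1; left.
  + by move=> a b h; apply: joined1; right; apply/YE.
Qed.

(* The test congruences for necessity: two of them differ on words of length 3 only. *)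
Definition coded (f : seq nat -> seq nat) (u v : seq nat) : Prop :=
  u = v \/ [/\ 2 < size u, 2 < size v, u =i v & f u = f v].

(** These conditions make [coded f] fully invariant: a nonempty context, or a substitution that
    lengthens some letter, leads to words longer than 3, where [f] is constant; all other
    substitutions act as renamings. *)
Definition coding (f : seq nat -> seq nat) : Prop :=
  (forall w, 3 < size w -> f w = [::]) /\
  (forall g u v, 2 < size u -> 2 < size v -> u =i v -> f u = f v -> f (map g u) = f (map g v)).

Lemma codedF f : coding f -> fully_invariant (coded f).
Proof.
move=> [f0 fg]; split.
- by left.
- by move=> u v [->|[h1 h2 uv e]]; [left|right; split=> // i; rewrite uv].
- move=> v u w [->//|[h1 h2 uv e]] [<-|[h1' h2' uv' e']]; right; split=> //.
    by move=> i; rewrite uv uv'.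
  by rewrite e.
- move=> a b u v [->|[h1 h2 uv e]]; first by left.
  have [a0|na] := eqVneq a [::]; last first.
    right; rewrite nonnilE in na; split; rewrite ?size_cat; try lia.
      by move=> i; rewrite !mem_cat uv.
    by rewrite !f0 // !size_cat; lia.
  have [b0|nb] := eqVneq b [::]; first by right; rewrite a0 b0 !cats0; split.
  right; rewrite nonnilE in nb; split; rewrite ?size_cat; try lia.
    by move=> i; rewrite !mem_cat uv.
  by rewrite !f0 // !size_cat; lia.
- move=> z u v nz [->|[h1 h2 uv e]]; [by left|right].
  have sub : subst z u =i subst z v.
    by move=> j; apply/mem_subst/mem_subst => -[k ku jk]; exists k; rewrite ?uv // -uv.
  have hu := size_subst u nz; have hv := size_subst v nz.
  split; try by [exact: sub|lia].
  case: (boolP (all (fun i => size (z i) == 1) u)) => [/allP h|/allPn[i iu zi]].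
    have zE w : w =i u -> subst z w = map (fun i => head 0 (z i)) w.
      move=> wu; rewrite -subst_single; apply: eq_subst => i; rewrite wu => /h.
      by case: (z i) => // x [].
    by rewrite !zE //; apply: fg.
  have big (w : seq nat) : i \in w -> size w < size (subst z w).
    case/splitPr=> A B; rewrite subst_cat subst_cons !size_cat /=.
    have := size_subst A nz; have := size_subst B nz; have := nz i; rewrite nonnilE; lia.
  have iv : i \in v by rewrite -uv.
  by have bu := big u iu; have bv := big v iv; rewrite !f0 //; lia.
Qed.

Lemma coded_nil f : reflects_nil (coded f).
Proof. by move=> w [<-|[]]. Qed.

(** * Permutations of three letters *)

Section Permutations.
Variable (k : nat).

Definition linear3 (w : seq nat) : bool := uniq w && (size w == 3).

(** Under this code [xyz] shares its class with one other word, obtained by the transposition fixing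
    position [k]. All other words of length at least 3 are separated by content alone. *)
Definition fixed_letter (w : seq nat) : seq nat :=
  if linear3 w then [:: nth 0 w k] else [::].

Lemma fixed_letter_coding : k < 3 -> coding fixed_letter.
Proof.
move=> k3; rewrite /fixed_letter; split=> [w sw|g u v su sv uv].
  by rewrite /linear3 (gtn_eqF sw) andbF.
have nlin w : ~~ linear3 w -> linear3 (map g w) = false.
  rewrite /linear3 size_map => h; apply/negP => /andP[/map_uniq uw sw].
  by rewrite uw sw in h.
case: (boolP (linear3 u)) (boolP (linear3 v)) => [lu|lu] [lv|lv] //; last by rewrite !nlin.
case/andP: lu lv => uu /eqP s3 /andP[univ /eqP s3'] [e].
have puv : perm_eq u v by apply: uniq_perm.
rewrite /linear3 (perm_uniq (perm_map g puv)) !size_map s3 s3'.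
by case: ifP => // _; rewrite !(nth_map 0) ?s3 ?s3' // e.
Qed.

End Permutations.

Definition transposition (k : nat) : seq nat :=
  nth [::] [:: [:: 0; 2; 1]; [:: 2; 1; 0]; [:: 1; 0; 2]] k.

(** A word [a] stands for the map sending [i] to [nth 0 a i], and [map (nth 0 b) a] is a composite.
    Applied twice, this reaches products of four. *)
Definition compositions (s : seq (seq nat)) : seq (seq nat) :=
  s ++ [seq map (nth 0 b) a | a <- s, b <- s].

Definition related3 (R : seq nat -> seq nat -> Prop) (a : seq nat) : Prop :=
  size a = 3 /\ R [:: 0; 1; 2] a.

Lemma compositionsP R s : fully_invariant R -> (forall a, a \in s -> related3 R a) ->
  forall a, a \in compositions s -> related3 R a.
Proof.
move=> RF h a; rewrite mem_cat => /orP[/h//|/allpairsP[[x y] /= [/h[sx Rx] /h[sy Ry] ->]]].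
split; first by rewrite size_map.
apply: (fi_trans RF Ry); have := fi_rename RF (nth 0 y) Rx.
by case: y sy {Ry} => [|y0 [|y1 [|y2 []]]].
Qed.

Definition permutations3 : seq (seq nat) :=
  [:: [:: 0; 1; 2]; [:: 0; 2; 1]; [:: 1; 0; 2]; [:: 1; 2; 0]; [:: 2; 0; 1]; [:: 2; 1; 0]].

Lemma permutations3P w : perm_eq w [:: 0; 1; 2] -> w \in permutations3.
Proof.
move=> h; have := perm_size h; have := perm_uniq h; have : all (ltn^~ 3) w.
  by apply/allP => i; rewrite (perm_mem h) !inE => /or3P[] /eqP->.
by case: w {h} => [|[|[|[|a]]] [|[|[|[|b]]] [|[|[|[|c]]] []]]].
Qed.

(** A transposition and another nontrivial permutation generate S_3; products of at most four
    factors already yield every transposition, by computation. *)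
Lemma transpositions_generated t k j R : fully_invariant R -> t \in permutations3 -> t != [:: 0; 1; 2] ->
  k < 3 -> j < 3 -> t != transposition k -> R [:: 0; 1; 2] t ->
  R [:: 0; 1; 2] (transposition k) -> R [:: 0; 1; 2] (transposition j).
Proof.
move=> RF tp t1 k3 j3 tk Rt Rk; set s := [:: t; transposition k].
suff js : transposition j \in compositions (compositions s).
  apply: (compositionsP RF (compositionsP RF _) js).2 => a; rewrite !inE => /orP[/eqP->|/eqP->].
    by split=> //; move: tp; rewrite !inE; do 5?[case/orP=> [/eqP->//|]]; move/eqP->.
  by split=> //; case: (k) k3 => [|[|[|]]].
have : all (fun t => all (fun k => [|| t == [:: 0; 1; 2], t == transposition k |
    all (fun j => transposition j \in compositions (compositions [:: t;
      transposition k])) (iota 0 3)])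
    (iota 0 3)) permutations3 by vm_compute.
move=> /allP/(_ t tp)/allP/(_ k); rewrite mem_iota => /(_ k3).
by rewrite (negPf t1) (negPf tk) => /allP/(_ j); rewrite mem_iota; apply.
Qed.

Lemma transposition_fixes k p : k < 3 -> p \in permutations3 -> nth 0 p k = k ->
  p = [:: 0; 1; 2] \/ p = transposition k.
Proof.
move=> k3 pp /eqP pk; have : all (fun p => all (fun k => (nth 0 p k == k) ==>
    ((p == [:: 0; 1; 2]) || (p == transposition k))) (iota 0 3)) permutations3 by vm_compute.
move=> /allP/(_ p pp)/allP/(_ k); rewrite mem_iota => /(_ k3).
by rewrite pk => /orP[] /eqP; [left|right].
Qed.

Section Transpositions.
Variables (V : variety) (t : seq nat).
Hypotheses (tp : t \in permutations3) (t1 : t != [:: 0; 1; 2]).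
Hypothesis (Vt : eqv V [:: 0; 1; 2] t).
Let nu := eqv V.

(** Two words in the same three distinct letters with equal [k]-th letters coincide or differ by
    [transposition k], which [nu] excludes; elsewhere the codes of [k] and [j] agree. *)
Lemma coded_fixed_letter k j u v : k < 3 -> ~ nu [:: 0; 1; 2] (transposition k) -> nu u v ->
  coded (fixed_letter k) u v -> coded (fixed_letter j) u v.
Proof.
move=> k3 nk nuv [->|[su sv uv]]; first by left.
rewrite /fixed_letter; case: (boolP (linear3 u)) (boolP (linear3 v)) => [lu|lu] [lv|lv] //;
  last first.
  by move=> _; right; split; rewrite // /fixed_letter (negPf lu) (negPf lv).
case/andP: lu lv => uu /eqP s3 /andP[univ /eqP s3'] [e]; left.
have puv : perm_eq u v by apply: uniq_perm.
have VF := eqvF V; pose f i := index i u; pose p := map f v.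
have fu : map f u = [:: 0; 1; 2].
  rewrite -[RHS]/(iota 0 3) -s3; apply: (@eq_from_nth _ 0); rewrite ?size_map ?size_iota // => i iu.
  by rewrite (nth_map 0) // nth_iota // /f index_uniq.
have nup : nu [:: 0; 1; 2] p by rewrite -fu; apply: fi_rename.
have pp : p \in permutations3.
  by apply: permutations3P; rewrite -fu /p perm_sym; apply: perm_map.
have pk : nth 0 p k = k by rewrite /p (nth_map 0) ?s3' // -e /f index_uniq ?s3.
have [p1|ptk] := transposition_fixes k3 pp pk.
  have inj : {in u &, injective f} by move=> x y xu yu; apply: index_inj.
  have allu : all (mem u) u by apply/allP.
  have allv : all (mem u) v by apply/allP => i; rewrite -uv.
  by apply: (inj_in_map inj allu allv); rewrite fu -p1.
by rewrite ptk in nup.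
Qed.

Lemma coded_join k j T : k < 3 -> j < 3 -> ~ nu [:: 0; 1; 2] (transposition k) ->
  fully_invariant T -> (forall u v, nu u v -> T u v) ->
  (forall u v, coded (fixed_letter k) u v -> T u v) ->
  forall u v, coded (fixed_letter j) u v -> T u v.
Proof.
move=> k3 j3 nk TF nuT kT.
have Tk : T [:: 0; 1; 2] (transposition k).
  apply: kT; right; case: (k) k3 => [|[|[|]]] // _; split=> //; move=> i; rewrite !inE; lia.
have tk : t != transposition k by apply/eqP => e; apply: nk; rewrite -e.
have Tj i : i < 3 -> T [:: 0; 1; 2] (transposition i).
  by move=> i3; apply: (transpositions_generated TF tp t1 k3 i3 tk) => //; apply: nuT.
have Tperm u v := perm_fi TF (u := u) (v := v) (Tj 2 isT) (Tj 0 isT).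
move=> u v [->|[su sv uv]]; first exact: fi_refl.
rewrite /fixed_letter; case: (boolP (linear3 u)) (boolP (linear3 v)) => [lu|lu] [lv|lv] //;
  last first.
  by move=> _; apply: kT; right; split; rewrite // /fixed_letter (negPf lu) (negPf lv).
move=> _; apply: Tperm => //; case/andP: lu lv => uu _ /andP[univ _].
exact: uniq_perm.
Qed.

(** If [nu] misses [transposition k], it misses another one, [transposition j], since two
    transpositions generate the third. The codes of [k] and [j] then have the same meet with [nu],
    and the same join because [t] and either transposition generate S_3; yet they differ. *)
Lemma all_transpositions k : cancellable V -> k < 3 -> nu [:: 0; 1; 2] (transposition k).
Proof.
move=> cV k3; apply: contrapT => nk.
have [j [j3 jk nj]] : exists j, [/\ j < 3, j != k & ~ nu [:: 0; 1; 2] (transposition j)].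
  apply: contrapT => nex; apply: nk.
  have h j : j < 3 -> j != k -> nu [:: 0; 1; 2] (transposition j).
    by move=> j3 jk; apply: contrapT => nj; apply: nex; exists j.
  have gen a b : a < 3 -> b < 3 -> a != k -> b != k -> a != b -> nu [:: 0; 1; 2] (transposition k).
    move=> a3 b3 ak bk ab; apply: (transpositions_generated (eqvF V) _ _ b3 k3 _ (h a a3 ak) (h b b3 bk)).
    - by case: (a) a3 => [|[|[|]]].
    - by case: (a) a3 => [|[|[|]]].
    - by case: (a) (b) a3 b3 ab => [|[|[|?]]] [|[|[|?]]].
  by case: (k) k3 gen => [|[|[|?]]] // _ gen;
     [apply: (gen 1 2)|apply: (gen 0 2)|apply: (gen 0 1)].
have RF := codedF (fixed_letter_coding k3); have SF := codedF (fixed_letter_coding j3).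
have := cancellable_fi cV RF SF (@coded_nil _) (@coded_nil _) _ _ (u := [:: 0; 1;
  2]) (v := transposition k).
case.
- by move=> u v uv; split; apply: coded_fixed_letter.
- by move=> T TF nuT; split; apply: coded_join.
- right; case: (k) k3 => [|[|[|]]] // _; split=> //; move=> i; rewrite !inE; lia.
- by case: (k) (j) k3 j3 jk => [|[|[|?]]] [|[|[|?]]].
- by case: (k) (j) k3 j3 jk => [|[|[|?]]] [|[|[|?]]] // _ _ _ [_ _ _] //=.
Qed.
End Transpositions.

(** * Nonlinear words *)

Definition swap_last (w : seq nat) : seq nat := if w is [:: a; b; c] then [:: a; c; b] else w.

Lemma swap_lastK : involutive swap_last.
Proof. by move=> [|a [|b [|c []]]]. Qed.

Lemma perm_swap_last w : perm_eq (swap_last w) w.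
Proof. by case: w => [|a [|b [|c []]]] //=; rewrite perm_cons (perm_catC [:: c] [:: b]). Qed.

Lemma map_swap_last g w : swap_last (map g w) = map g (swap_last w).
Proof. by case: w => [|a [|b [|c []]]]. Qed.

Lemma swap_last_coding f : coding f -> coding (f \o swap_last).
Proof.
move=> [f0 fg]; split=> [w sw|g u v su sv uv] /=.
  by apply: f0; rewrite (perm_size (perm_swap_last w)).
rewrite !map_swap_last; apply: fg; rewrite ?(perm_size (perm_swap_last _)) //.
by move=> i; rewrite !(perm_mem (perm_swap_last _)).
Qed.

Lemma pair_content (a b c d : nat) : [:: a; b] =i [:: c; d] -> a != b -> c != d ->
  (c = a /\ d = b) \/ (c = b /\ d = a).
Proof.
move=> st ab cd.
have : c \in [:: a; b] by rewrite st !inE eqxx.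
have : d \in [:: a; b] by rewrite st !inE eqxx orbT.
rewrite !inE => /orP[] /eqP ed /orP[] /eqP ec; subst; rewrite ?eqxx // in cd *; by [left|right].
Qed.

Lemma palindrome_content (a b c d : nat) : [:: a; b; a] =i [:: c; d; c] -> a != b -> c != d ->
  (c = a /\ d = b) \/ (c = b /\ d = a).
Proof.
move=> st; apply: pair_content => i; have := st i; rewrite !inE.
by case: (i == a); case: (i == b); case: (i == c); case: (i == d).
Qed.

Lemma square_content (a b c d : nat) : [:: a; a; b] =i [:: c; c; d] -> a != b -> c != d ->
  (c = a /\ d = b) \/ (c = b /\ d = a).
Proof. by move=> st; apply: pair_content => i; have := st i; rewrite !inE !orbA !orbb. Qed.

Section Nonlinear.
Variable V : variety.
Hypothesis cV : cancellable V.
Let nu := eqv V.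
Hypothesis nuperm : forall u v : seq nat, perm_eq u v -> 2 < size u -> nu u v.
Let nuF : fully_invariant nu := eqvF V.

(** [nu] relates each [w] longer than 2 to [swap_last w], so both congruences have the same join
    with [nu]. As the swap is an involution, the one-sided hypothesis yields equal meets. *)
Lemma coded_swap f : coding f ->
  (forall u v, nu u v -> coded f u v -> coded (f \o swap_last) u v) ->
  forall u v, coded f u v -> coded (f \o swap_last) u v.
Proof.
move=> fc h; have fc' := swap_last_coding fc.
have nusw w : 2 < size w -> nu w (swap_last w).
  by move=> sw; apply: nuperm => //; rewrite perm_sym perm_swap_last.
have coded_sw g u v : coded g u v -> coded (g \o swap_last) (swap_last u) (swap_last v).
  move=> [->|[su sv uv e]]; [by left|right].
  split; rewrite ?(perm_size (perm_swap_last _)) //=; last by rewrite !swap_lastK.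
  by move=> i; rewrite !(perm_mem (perm_swap_last _)).
have ffK : (f \o swap_last) \o swap_last = f by apply/funext => w; rewrite /= swap_lastK.
have nusw' u v : nu u v -> 2 < size u -> 2 < size v -> nu (swap_last u) (swap_last v).
  move=> uv su sv; apply: (fi_trans nuF (fi_sym nuF (nusw _ su))).
  by apply: (fi_trans nuF uv); apply: nusw.
have joins g T : fully_invariant T -> (forall u v, nu u v -> T u v) ->
    (forall u v, coded g u v -> T u v) -> forall u v, coded (g \o swap_last) u v -> T u v.
  move=> TF nuT gT u v [->|[su sv uv e]]; first exact: fi_refl.
  apply: (fi_trans TF (nuT _ _ (nusw _ su)));
    apply: (fi_trans TF) (fi_sym TF (nuT _ _ (nusw _ sv))).
  apply: gT; right; split; rewrite ?(perm_size (perm_swap_last _)) //.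
  by move=> i; rewrite !(perm_mem (perm_swap_last _)).
apply: (cancellable_fi cV (codedF fc) (codedF fc') (@coded_nil _) (@coded_nil _)).
- move=> u v uv; split; first exact: h.
  move=> huv; case: (huv) => [->|[su sv _ _]]; first by left.
  have := h _ _ (nusw' _ _ uv su sv); have := coded_sw _ _ _ huv; rewrite ffK => h1 /(_ h1).
  by move=> /(coded_sw (f \o swap_last)); rewrite ffK !swap_lastK.
- move=> T TF nuT; split; first exact: joins.
  by move=> hT; have := joins (f \o swap_last) T TF nuT hT; rewrite ffK.
Qed.

Definition palindrome_code (w : seq nat) : seq nat :=
  if w is [:: a; b; c] then (if (a == c) && (a != b) then [:: 0] else w) else [::].

Lemma palindrome_code_coding : coding palindrome_code.
Proof.
split=> [[|a [|b [|c [|d w]]]] //|g u v].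
case: u => [|a [|b [|c [|d u]]]] // ; case: v => [|a' [|b' [|c' [|d' v]]]] //= _ _ uv;
  do ?[by case: ifP].
case: ifP => [/andP[/eqP ac ab]|_]; case: ifP => [/andP[/eqP ac' ab']|_] //;
  last by move=> [-> -> ->].
move=> _; subst c c'.
have [[-> ->]|[-> ->]] := palindrome_content uv ab ab'; first by [].
by rewrite !eqxx /= (eq_sym (g b)); case: eqP => //= ->.
Qed.

(* [palindrome_code] identifies aba with bab; composed with the swap, it identifies aab with bba. *)
Lemma nu_xxy_yyx : nu [:: 0; 0; 1] [:: 1; 1; 0].
Proof.
apply: contrapT => nxy.
have := @coded_swap _ palindrome_code_coding _ [:: 0; 1; 0] [:: 1; 0; 1].
case => //; last 2 first.
- by right; split=> // i; rewrite !inE; case: (i == 0); case: (i == 1).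
- by case.
move=> u v uv [->|[su sv cuv]]; first by left.
case: u su uv cuv => [|a [|b [|c [|d u]]]] // _;
  case: v sv => [|a' [|b' [|c' [|d' v]]]] // _ uv cuv /=;
  do ?[by case: ifP].
  case: ifP => [/andP[/eqP ac ab]|_]; case: ifP => [/andP[/eqP ac' ab']|_] //; last first.
    by move=> [-> -> ->] ; left.
  move=> _; subst c c'.
  have [[ea eb]|[ea eb]] := palindrome_content cuv ab ab'; first by left; rewrite ea eb.
  case: nxy; pose f i := if i == a then 0 else 1.
  have := fi_rename nuF f uv; rewrite /= ea eb /f !eqxx (eq_sym b) (negPf ab) => h.
  apply: (fi_trans nuF (nuperm (v := [:: 0; 1; 0]) _ _)) => //.
  by apply: (fi_trans nuF h); apply: nuperm.
by move=> _; right.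
Qed.

(** For distinct [a], [b] the word [aba] joins the class of all longer words in these letters, while
    [aab] is only identified with [bba]; the swap exchanges the two behaviours. *)
Definition collapse_code (w : seq nat) : seq nat :=
  if w is [:: a; b; c] then (if a == c then [::] else if a == b then [:: 0] else w) else [::].

Lemma collapse_code_coding : coding collapse_code.
Proof.
split=> [[|a [|b [|c [|d w]]]] //|g u v].
case: u => [|a [|b [|c [|d u]]]] // ; case: v => [|a' [|b' [|c' [|d' v]]]] //= _ _ uv.
- case: (eqVneq a c) => [ac|ac]; case: (eqVneq a' c') => [ac'|ac'].
  + by rewrite ac ac' !eqxx.
  + by case: ifP.
  + by case: ifP.
  case: (eqVneq a b) => [ab|ab]; case: (eqVneq a' b') => [ab'|ab'] //; last by move=> [-> -> ->].
  move=> _; subst b b'; have [[-> ->]|[-> ->]] := square_content uv ac ac'; first by [].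
  by rewrite !eqxx (eq_sym (g c)).
- by case: (eqVneq a c) => [->|_]; rewrite ?eqxx //; case: ifP.
- by case: (eqVneq a' c') => [->|_]; rewrite ?eqxx //; case: ifP.
Qed.

(** Otherwise [nu] relates no [aba] with distinct [a], [b] to a longer word of the same content, and
    [collapse_code] has the same meet with [nu] before and after the swap. Only before the swap is
    [010] related to [0100]. *)
Lemma nu_xxy_long : exists q, [/\ 3 < size q, q =i [:: 0; 1] & nu [:: 0; 0; 1] q].
Proof.
apply: contrapT => nq.
have no_long a b v : a != b -> 3 < size v -> [:: a; b; a] =i v -> ~ nu [:: a; b; a] v.
  move=> ab sv uv huv; apply: nq; pose f i := if i == a then 0 else 1.
  have e : map f [:: a; b; a] = [:: 0; 1; 0] by rewrite /= /f eqxx (eq_sym b) (negPf ab).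
  exists (map f v); split; first by rewrite size_map.
    by move=> i; rewrite -(eq_mem_map f uv) e !inE; case: (i == 0); case: (i == 1).
  apply: (fi_trans nuF (nuperm (v := [:: 0; 1; 0]) _ _)) => //.
  by rewrite -e; apply: fi_rename.
have := @coded_swap _ collapse_code_coding _ [:: 0; 1; 0] [:: 0; 1; 0; 0].
case => //; last 2 first.
- by right; split=> // i; rewrite !inE; case: (i == 0); case: (i == 1).
- by case.
move=> u v uv [->|[su sv cuv e]]; first by left.
right; split=> //; move: su sv cuv uv e.
case: u => [|a [|b [|c [|d u]]]] //= _; case: v => [|a' [|b' [|c' [|d' v]]]] //= _ cuv uv.
- case: (eqVneq a c) => [ac|ac]; case: (eqVneq a' c') => [ac'|ac'] /=.
  + move=> _; subst c c'; case: (eqVneq a b) => [ab|ab]; case: (eqVneq a' b') => [ab'|ab'] //.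
    * by have := cuv b'; have := cuv a'; rewrite -ab !inE !eqxx !orbT !orbb => /eqP <- /eqP e;
      rewrite e eqxx in ab'.
    * by have := cuv b; have := cuv a;
      rewrite -ab' !inE !eqxx !orbT !orbb => /esym/eqP <- /esym/eqP e; rewrite e eqxx in ab.
  + by case: ifP.
  + by case: ifP.
  case: (eqVneq a b) => [ab|ab]; case: (eqVneq a' b') => [ab'|ab'] //.
  by move=> [-> -> ->].
- case: (eqVneq a c) => [ac|ac] /=; last by case: ifP.
  subst c => _; case: (eqVneq a b) => [//|ab].
  by case: (no_long a b _ ab _ cuv uv).
- case: (eqVneq a' c') => [ac'|ac'] /=; last by case: ifP.
  subst c' => _; case: (eqVneq a' b') => [//|ab'].
  by case: (no_long a' b' _ ab' _ (fsym cuv) (fi_sym nuF uv)).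
Qed.

Let word01 i j := nseq i 0 ++ nseq j 1.

(** By [nu_xxy_yyx] and permutations, only the length of [0^i 1^j] matters. Doubling [0] in that
    identity links lengths 5 and 4, hence all lengths from 4 on; [nu_xxy_long] adds length 3. *)
Lemma nu_word01 i j : 3 <= i + j -> 0 < i -> 0 < j -> nu (word01 i j) [:: 0; 0; 1].
Proof.
have shift i' j' : nu (word01 i'.+2 j'.+1) (word01 i'.+1 j'.+2).
  have h : nu [:: 0; 0; 1] [:: 0; 1; 1].
    by apply: (fi_trans nuF nu_xxy_yyx); apply: nuperm.
  have := fi_cat nuF (nseq i' 0) (nseq j' 1) h; rewrite /word01.
  have -> : nseq i'.+2 0 = nseq i' 0 ++ [:: 0; 0] by rewrite -(nseqD _ 2) addn2.
  have -> : nseq i'.+1 0 = nseq i' 0 ++ [:: 0] by rewrite -(nseqD _ 1) addn1.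
  by rewrite -!catA.
have one i' j' : 0 < i' -> nu (word01 i' j'.+1) (word01 (i' + j') 1).
  elim: j' i' => [|j' IHj] [|i'] // _; first by rewrite addn0; apply: fi_refl.
  apply: (fi_trans nuF (fi_sym nuF (shift i' j'))); rewrite -addSnnS; exact: (IHj i'.+2 isT).
have step3 : nu (word01 3 1) (word01 4 1).
  have nz : nonerasing (fun k => if k is 0 then [:: 0; 0] else [:: k]) by case.
  have := fi_subst nuF nz nu_xxy_yyx; rewrite /subst /= => h.
  apply: (fi_trans nuF (fi_sym nuF (one 2 1 isT))); apply: (fi_sym nuF).
  by apply: (fi_trans nuF h); apply: nuperm.
have step k : nu (word01 k.+3 1) (word01 3 1).
  elim: k => [|k IHk]; first exact: fi_refl.
  apply: (fi_trans nuF) IHk; have := fi_catl nuF (nseq k 0) step3; rewrite /word01 !catA -!nseqD.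
  by rewrite !addnS addn0 => /(fi_sym nuF).
have nu3 : nu [:: 0; 0; 1] (word01 3 1).
  have [q [sq q01 hq]] := nu_xxy_long; apply: (fi_trans nuF hq).
  have pq : perm_eq q (word01 (count_mem 0 q) (count_mem 1 q)).
    apply/allP => x _ /=; rewrite count_cat !count_nseq /=.
    case: x => [|[|x]] /=; rewrite ?mul1n ?mul0n ?addn0 ?add0n //.
    by apply/eqP/count_memPn; rewrite q01.
  apply: (fi_trans nuF (nuperm pq (ltnW sq))).
  have c0 : 0 < count_mem 0 q by rewrite -has_count has_pred1 q01.
  have c1 : 0 < count_mem 1 q by rewrite -has_count has_pred1 q01.
  have := perm_size pq; rewrite size_cat !size_nseq => sz.
  rewrite -(prednK c1); apply: (fi_trans nuF (one _ _ c0)).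
  rewrite -(subnKC (_ : 3 <= count_mem 0 q + (count_mem 1 q).-1)); first exact: step.
  lia.
move=> ij i0 j0; rewrite -(prednK j0); apply: (fi_trans nuF (one _ _ i0)).
have [e|] := eqVneq (i + j.-1) 2; first by rewrite e; apply: fi_refl.
move=> ne; have ge3 : 3 <= i + j.-1 by lia.
rewrite -(subnKC ge3); apply: (fi_trans nuF (step _)); exact: fi_sym.
Qed.

(** A permutation brings [w] to the form [iiy s], where [x] is [i] or can be chosen as [y]. The
    pairs [iiy], [iiiy] and [iiy], [iiyy] come from [nu_word01]. *)
Lemma nu_absorb1 w x : long_nonlinear w -> x \in w -> nu w (w ++ [:: x]).
Proof.
case/andP=> sw nuw xw; have [i [A [B [C e]]]] := not_uniq_split nuw.
have pw : perm_eq w ([:: i; i] ++ (A ++ B ++ C)).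
  rewrite e /= -cat1s perm_catCA /= perm_cons -cat1s.
  by rewrite (catA A B) perm_catCA /= perm_cons catA.
have absorb y s k : perm_eq w ([:: i; i; y] ++ s) ->
    nu [:: i; i; y] ([:: i; i; y] ++ [:: k]) -> nu w (w ++ [:: k]).
  move=> pwy hk; apply: (fi_trans nuF (nuperm pwy sw)).
  apply: (fi_trans nuF (fi_catr nuF s hk)); apply: nuperm; last by rewrite !size_cat.
  by rewrite -catA perm_sym (permPl (perm_cat pwy (perm_refl _))) -catA perm_cat2l perm_catC.
pose f (y : nat) k := if k == 0 then i else y.
have F1 y : nu [:: i; i; y] ([:: i; i; y] ++ [:: i]).
  have h := fi_sym nuF (@nu_word01 3 1 isT isT isT); have := fi_rename nuF (f y) h.
  by move=> h'; apply: (fi_trans nuF h'); apply: nuperm => //=;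
    rewrite !perm_cons (perm_catC [:: i] [:: y]).
have F2 y : nu [:: i; i; y] ([:: i; i; y] ++ [:: y]).
  have h := fi_sym nuF (@nu_word01 2 2 isT isT isT); exact: (fi_rename nuF (f y) h).
have [xi|xi] := eqVneq x i.
  move: pw; case: (A ++ B ++ C) => [|y s] pw; first by move: sw; rewrite (perm_size pw).
  by rewrite xi; apply: absorb (F1 y); exact: pw.
have xs : x \in A ++ B ++ C by move: xw; rewrite (perm_mem pw) !inE (negPf xi).
apply: absorb (F2 x); apply: (perm_trans pw); rewrite /= !perm_cons.
exact: perm_to_rem.
Qed.

Lemma long_nonlinear_cat a w b : long_nonlinear w -> long_nonlinear (a ++ w ++ b).
Proof.
case/andP=> sw nuw; rewrite /long_nonlinear !size_cat; apply/andP; split; first by lia.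
by apply: contra nuw; rewrite !cat_uniq => /and3P[_ _ /andP[]].
Qed.

Lemma nu_absorb w s : long_nonlinear w -> {subset s <= w} -> nu w (w ++ s).
Proof.
move=> lw; elim/last_ind: s => [|s x IHs] sw; first by rewrite cats0; apply: fi_refl.
have ss : {subset s <= w} by move=> i si; apply: sw; rewrite mem_rcons inE si orbT.
apply: (fi_trans nuF (IHs ss)); rewrite -cats1 catA; apply: nu_absorb1.
  exact: (long_nonlinear_cat [::]).
by rewrite mem_cat sw // mem_rcons mem_head.
Qed.

Lemma nu_content u v : long_nonlinear u -> long_nonlinear v -> u =i v -> nu u v.
Proof.
move=> lu lv uv; apply: (fi_trans nuF (nu_absorb lu (_ : {subset v <= u}))) => [i|].
  by rewrite uv.
apply: (fi_trans nuF (nuperm (v := v ++ u) _ _)); first by rewrite perm_catC.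
  by rewrite size_cat; case/andP: lu => ? _; lia.
by apply: (fi_sym nuF); apply: nu_absorb => // i; rewrite uv.
Qed.
End Nonlinear.

(** * The decomposition of a cancellable variety *)

Lemma long_nonlinear_subst z w : nonerasing z -> long_nonlinear w -> long_nonlinear (subst z w).
Proof.
move=> nz /andP[sw nuw]; rewrite /long_nonlinear (leq_trans sw) ?size_subst //=.
apply: contra nuw; elim: w {sw} => //= x w IHw; rewrite subst_cons cat_uniq => /and3P[_ hxw uw].
rewrite IHw // andbT; apply: contra hxw => xw.
have : head 0 (z x) \in z x by have := nz x; case: (z x) => // y s _; apply: mem_head.
by move=> hx; apply/hasP; exists (head 0 (z x)) => //; apply/mem_subst; exists x.
Qed.

Lemma permutational3 e : permutational 3 e ->
  letters e.1 = [:: 0; 1; 2] /\ exists2 t, t \in permutations3 & t != [:: 0; 1;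
    2] /\ letters e.2 = t.
Proof.
case=> pi [pi1 e1 e2]; have en : [seq val i | i <- enum 'I_3] = [:: 0; 1;
  2] by rewrite val_enum_ord.
split; first by rewrite e1 en.
exists (letters e.2) => //; rewrite e2; last first.
  split=> //; apply: contraNneq pi1 => h; apply/eqP/permP => i; rewrite perm1; apply: val_inj.
  by move: h; rewrite -en => /eq_in_map -> //; rewrite mem_enum.
apply: permutations3P; rewrite -en map_comp; apply: perm_map; apply: uniq_perm.
- by rewrite (map_inj_uniq (@perm_inj _ pi)) enum_uniq.
- exact: enum_uniq.
- move=> i; rewrite mem_enum; apply/mapP; exists ((pi^-1)%g i); first by rewrite mem_enum.
  by rewrite permKV.
Qed.

Lemma satisfies_eqv V (u v : word) a b : letters u = a -> letters v = b ->
  eqv V a b -> satisfies V (u ≈ v).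
Proof. by move=> <- <- /eqvE. Qed.

(** By [nu_content], long nonlinear words of equal content are related. If some identity of [V]
    changes content, the archimedean law relates all of them, and [V] itself serves as [N];
    otherwise they are merged to form [N], and [SL] restores the content. *)
Lemma decomposition_of_cancellable (V : variety) :
  (exists2 e, permutational 3 e & satisfies V e) -> cancellable V ->
  exists M N : variety,
    [/\ M = trivial_variety \/ M = semilattice_variety,
        forall u v : seq nat, perm_eq u v -> 2 < size u -> eqv N u v,
        forall u v, long_nonlinear u -> long_nonlinear v -> eqv N u v &
        V = (M `|` N)%O].
Proof.
move=> [[u v] /permutational3[/= e1 [t tp [t1 e2]]] Vuv] cV.
pose nu := eqv V; have nuF : fully_invariant nu := eqvF V.
have Vt : eqv V [:: 0; 1; 2] t by rewrite -e1 -e2; apply/eqvE.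
have nuperm x y : perm_eq x y -> 2 < size x -> nu x y.
  exact: (perm_fi nuF (all_transpositions tp t1 Vt (k := 2) cV isT) (all_transpositions tp t1 Vt
    (k := 0) cV isT)).
have nuC := nu_content cV nuperm.
have [[p [q [npq pq]]]|same] := pselect (exists p q, nu p q /\ ~ p =i q).
  exists trivial_variety, V; split; [by left|exact: nuperm| |]; last first.
    apply: variety_ext => x y; split=> [[e h]|/eqv_join[]//].
    by apply/eqv_join; split=> //; apply/eqv_trivial.
  have [K K0 /(_ 1 isT) aK] := archimedean_of_identity nuF (@eqv_nil V) npq pq.
  rewrite muln1 in aK.
  have mempow s i : (i \in power s K) = (i \in s).
    by rewrite -(prednK K0); elim: K.-1 => [|n IHn]; rewrite ?power1 // powerS mem_cat IHn orbb.
  have lpow w : long_nonlinear w -> long_nonlinear (power w K).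
    move=> lw; rewrite -(prednK K0) powerS; exact: (long_nonlinear_cat [::]).
  (* The path is [x], [x^K], [(x^K y x^K)^K], [x y]; its first and last steps compare words of equal
     content. *)
  have absorb x y : long_nonlinear x -> long_nonlinear y -> nu x (x ++ y).
    move=> lx ly; have nx : x != [::] by case: (x) lx.
    have ny : y != [::] by case: (y) ly.
    apply: (fi_trans nuF (nuC _ _ lx (lpow _ lx) _)) => [i|]; first by rewrite mempow.
    apply: (fi_trans nuF (aK x y nx ny)); apply: nuC; last 1 first.
    - by move=> i; rewrite mempow !mem_cat !mempow; case: (i \in x); case: (i \in y).
    - by apply: (lpow); apply: (long_nonlinear_cat [::]); apply: lpow.
    - exact: (long_nonlinear_cat [::]).
  move=> x y lx ly; apply: (fi_trans nuF (absorb x y lx ly)).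
  apply: (fi_trans nuF (nuperm _ (y ++ x) _ _)); first by rewrite perm_catC.
    by rewrite size_cat ltn_addr //; case/andP: lx.
  by apply: (fi_sym nuF); apply: absorb.
have {}same p q : nu p q -> p =i q by move=> pq; apply: contrapT => npq; apply: same; exists p, q.
(* [rho] merges all [nu]-classes that contain a long nonlinear word. Since [nu] preserves content
   here, equal content together with [rho] gives back [nu]. *)
pose z w := exists2 w', long_nonlinear w' & nu w w'.
pose rho x y := nu x y \/ z x /\ z y.
have zT x y : nu x y -> z y -> z x by move=> xy [w lw yw]; exists w => //; apply: (fi_trans nuF xy).
have rhoF : fully_invariant rho.
  split.
  - by left; apply: fi_refl.
  - by move=> x y [h|[]]; [left; apply: fi_sym|right].
  - move=> y x w [h|[zx zy]] [h'|[zy' zw]]; [by left; apply: (fi_trans nuF h)|right..].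
    + by split=> //; apply: zT h zy'.
    + by split=> //; apply: zT zy; apply: fi_sym.
    + by [].
  - move=> a b x y [h|[[x' lx hx] [y' ly hy]]]; [by left; apply: fi_cat|right].
    by split; [exists (a ++ x' ++ b)|exists (a ++ y' ++ b)];
      [exact: long_nonlinear_cat|exact: fi_cat..|exact: long_nonlinear_cat|exact: fi_cat].
  - move=> f x y nf [h|[[x' lx hx] [y' ly hy]]]; [by left; apply: fi_subst|right].
    by split; [exists (subst f x')|exists (subst f y')];
      [exact: long_nonlinear_subst|exact: fi_subst..|exact: long_nonlinear_subst|exact: fi_subst].
have rhonil : reflects_nil rho.
  by move=> w [/eqv_nil//|[[w' lw /eqv_nil w0]]]; rewrite w0 in lw.
have rhoE := eqv_variety_of rhoF rhonil.
exists semilattice_variety, (variety_of_fi rho); split; first by right.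
- by move=> x y xy sx; apply/rhoE; left; apply: nuperm.
- by move=> x y lx ly; apply/rhoE; right; split; [exists x|exists y] => //; apply: fi_refl.
apply: variety_ext => x y; split=> [h|/eqv_join[/eqv_semilattice xy /rhoE[//|]]].
  by apply/eqv_join; split; [apply/eqv_semilattice; exact: same|apply/rhoE; left].
move=> [[x' lx hx] [y' ly hy]]; apply: (fi_trans nuF hx); apply: (fi_trans nuF) (fi_sym nuF hy).
by apply: nuC => // i; rewrite -(same _ _ hx) -(same _ _ hy) xy.
Qed.

Theorem theorem1p1 (V : variety)
  (hV : exists2 e : identity, permutational 3 e & satisfies V e) :
  cancellable V <->
  exists M N : variety,
    let x := letter 0 in let y := letter 1 in let z := letter 2 in
    [/\ M = trivial_variety \/ M = semilattice_variety,
        satisfies N (x ⋅ y ⋅ z ≈ y ⋅ x ⋅ z),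
        satisfies N (y ⋅ x ⋅ z ≈ x ⋅ z ⋅ y),
        satisfies_zero N (x ⋅ x ⋅ y) &
        V = (M `|` N)%O].
Proof.
split=> [/(decomposition_of_cancellable hV)[M [N [hM Nperm Nzero eV]]]|].
  exists M, N; split=> //.
  - by apply: (satisfies_eqv erefl erefl); apply: Nperm.
  - by apply: (satisfies_eqv erefl erefl); apply: Nperm.
  - have xxy a b : long_nonlinear (a ++ [:: 0; 0; 1] ++ b) by apply: long_nonlinear_cat.
    move=> t _; split; apply: (satisfies_eqv erefl erefl); apply: Nzero.
    + exact: (xxy [:: t] [::]).
    + exact: (xxy [::] [:: t]).
    + exact: (xxy [::] [:: t]).
    + by [].
case=> M [N [hM /eqvE/= N1 /eqvE/= N2 N0 eV]].
have [/eqvE/= N3 /eqvE/= N4] := N0 2 isT.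
exact: (cancellable_of_decomposition hM N1 (fi_trans (eqvF N) N1 N2) N3 N4 eV).
Qed.
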